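(* There exist universal constants $0<c_0<C_0<\infty$ (independent of $d$, $R$, $B$ and $n$) such that the following holds. Let $R\in M_d(\mathbb{Z})$ be expansive and let $B\subset\mathbb{Z}^d$ be a simple digit set for $R$ with $N=\#B$. Then for every $n\ge1$ there exists a set $J_n\subset\mathbb{Z}^d$ such that $$c_0\sum_{b\in B_n}|w_b|^2\le\sum_{\lambda\in J_n}\left|\frac{1}{\sqrt{N^n}}\sum_{b\in B_n}w_be^{-2\pi i\langle R^{-n}b,\lambda\rangle}\right|^2\le C_0\sum_{b\in B_n}|w_b|^2$$ for all $(w_b)_{b\in B_n}\in\mathbb{C}^{N^n}$.
   Context: A matrix is expansive if all its eigenvalues have modulus $>1$. A finite set $B\subset\mathbb{Z}^d$ is a simple digit set for $R$ if distinct elements of $B$ are not congruent modulo $R(\mathbb{Z}^d)$. $B_n=\{\sum_{j=0}^{n-1}R^jb_j:b_j\in B\}$ (so $\#B_n=N^n$). *)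

(* Defs.v *)
From HB Require Import structures.
From mathcomp Require Import all_boot all_order all_algebra.
From mathcomp Require Import finmap.
From mathcomp Require Import all_classical all_reals all_analysis.
From mathcomp Require Import complex.

Set Implicit Arguments.
Unset Strict Implicit.
Unset Printing Implicit Defensive.

Import Order.TTheory GRing.Theory Num.Theory Normc.

Local Open Scope ring_scope.
Local Open Scope fset_scope.
Local Open Scope complex_scope.

(* [eigenvalue] is about row eigenvectors, but a square matrix and its
   transpose have the same eigenvalues. *)
Definition expansive (K : realType) (d : nat) (R : 'M[int]_d) : Prop :=
  forall z : K[i], eigenvalue (map_mx intr R) z -> 1 < normc z.

Definition simple_digit_set (d : nat) (R : 'M[int]_d)
    (B : {fset 'cV[int]_d}) : Prop :=
  {in B &, forall b b', (exists z : 'cV[int]_d, b - b' = R *m z) -> b = b'}.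

Definition digit_sums (d : nat) (R : 'M[int]_d) (B : {fset 'cV[int]_d})
    (n : nat) : {fset 'cV[int]_d} :=
  [fset \sum_(j < n) R ^+ j *m val (f j)
    | f : {ffun 'I_n -> B} in {: {ffun 'I_n -> B}}].

Definition cis (K : realType) (t : K) : K[i] := cos t +i* sin t.

Definition intr_mx (K : realType) (m n : nat) (M : 'M[int]_(m, n)) :
  'M[K]_(m, n) := map_mx intr M.

Definition dotv (K : realType) (d : nat) (u v : 'cV[K]_d) : K :=
  \sum_(i < d) u i 0 * v i 0.

Definition digit_phase (K : realType) (d : nat) (R : 'M[int]_d) (n : nat)
    (b l : 'cV[int]_d) : K :=
  dotv (invmx (intr_mx K R ^+ n) *m intr_mx K b) (intr_mx K l).

Definition normalized_fourier (K : realType) (d : nat) (R : 'M[int]_d)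
    (B : {fset 'cV[int]_d}) (n : nat) (w : digit_sums R B n -> K[i])
    (l : 'cV[int]_d) : K[i] :=
  (1 / Num.sqrt ((#|` B| ^ n)%N%:R))%:C *
  \sum_(b : digit_sums R B n) w b * cis (- (2 * pi * digit_phase K R n (val b) l)).

(* Main.v *)
Require Import Defs.
From HB Require Import structures.
From mathcomp Require Import all_boot all_order all_algebra.
From mathcomp Require Import finmap.
From mathcomp Require Import all_classical all_reals all_analysis.
From mathcomp Require Import complex ring lra.

(* For [x] with entries in the integer box [0, |det R^n|)^d, the vectors
   [u_x = (e^(-2 pi i <R^-n b, x>) / sqrt #B_n)_b] are unit vectors forming a
   tight frame, because the digit sums are pairwise incongruent modulo [R^n].
   It therefore suffices to thin a tight frame of unit vectors down to a
   subframe with universal bounds. This is done by repeated halving: a frame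
   with lower bound [a] splits into two parts, each of whose frame operators is
   at most [1/2 + 2/sqrt a] times the original one; along the halvings the
   errors form a geometric series, so only a bounded factor is lost.

   The halving step is the Marcus-Spielman-Srivastava argument in a multiaffine
   form. Put [h z = det (sum_l z_l u_l^* u_l)] and [P (z, z') = h z * h z'] with
   independent variables for the two parts. [P] is affine in each variable, real
   on real points and nonvanishing when all variables lie in the upper half
   plane. Putting [u_l] in one part or the other amounts to replacing [z_l] by
   [z_l - 1] or [z'_l] by [z'_l - 1], and averaging over this choice preserves
   the three properties, hence also Rayleigh's inequality
   [f * d_i d_j f <= d_i f * d_j f] on real points. That inequality makes the
   barriers [d_i f / f] decreasing and convex above the zeros of [f], which
   bounds the zeros of the averaged polynomial; and it lets one undo the averages
   one at a time, always keeping one of the two choices. *)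

Set Implicit Arguments.
Unset Strict Implicit.
Unset Printing Implicit Defensive.

Import Order.TTheory GRing.Theory Num.Theory Normc.

Local Open Scope ring_scope.
Local Open Scope complex_scope.

(** * Multiaffine functions and barriers *)

Definition bump (F : fieldType) (I : eqType) (z : I -> F) (i : I) (s : F) :
  I -> F := fun j => if j == i then z j + s else z j.

(** On a multiaffine [f] this unit difference is the partial derivative in the variable [i], so the
    calculus stays algebraic. *)
Definition diff (F : fieldType) (I : eqType) (i : I) (f : (I -> F) -> F)
  (z : I -> F) : F := f (bump z i 1) - f z.

Definition multiaffine (F : fieldType) (I : eqType) (f : (I -> F) -> F) :=
  forall z i s, f (bump z i s) = f z + s * diff i f z.

(** On multiaffine [f] this is the operator [1 - (d_i + d_j) / 2]. *)
Definition avg (F : fieldType) (I : eqType) (i j : I) (f : (I -> F) -> F) :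
  (I -> F) -> F := fun z => 2^-1 * (f (bump z i (-1)) + f (bump z j (-1))).

Section Multiaffine.
Variables (F : fieldType) (I : eqType).
Implicit Types (z : I -> F) (i j k : I) (f : (I -> F) -> F).

Lemma bump0 z i : bump z i 0 = z.
Proof. by apply: funext => j; rewrite /bump addr0 if_same. Qed.

Lemma bumpD z i s t : bump (bump z i s) i t = bump z i (s + t).
Proof. by apply: funext => j; rewrite /bump; case: eqP => // _; rewrite addrA. Qed.

Lemma bumpC z i j s t : bump (bump z i s) j t = bump (bump z j t) i s.
Proof.
by apply: funext => k; rewrite /bump; case: eqP => // _; case: eqP => // _;
  rewrite addrAC.
Qed.

Lemma diff_bump f z i s : multiaffine f -> diff i f (bump z i s) = diff i f z.
Proof. by move=> hf; rewrite {1}/diff bumpD !hf; ring. Qed.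

Lemma diffC f i j z : diff i (diff j f) z = diff j (diff i f) z.
Proof. by rewrite /diff bumpC; ring. Qed.

Lemma multiaffine_diff f i : multiaffine f -> multiaffine (diff i f).
Proof.
move=> hf z j s; rewrite {1}/diff bumpC !(hf _ j) /diff ![bump (bump z j _) _ _]bumpC.
by ring.
Qed.

Lemma avgE f i j z : (2 : F) != 0 -> multiaffine f ->
  avg i j f z = f z - 2^-1 * (diff i f z + diff j f z).
Proof.
by move=> u2 hf; rewrite /avg !hf; field.
Qed.

Lemma multiaffine_avg f i j : multiaffine f -> multiaffine (avg i j f).
Proof.
move=> hf z k s; rewrite /diff /avg ![bump (bump z k _) _ _]bumpC.
by rewrite !(hf (bump _ _ (-1)) k) mul1r /=; ring.
Qed.

Lemma diff_diag f i z : multiaffine f -> diff i (diff i f) z = 0.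
Proof. by move=> hf; rewrite {1}/diff diff_bump // subrr. Qed.

Hypothesis two_neq0 : (2 : F) != 0.

Lemma diff_avg f i j k z : multiaffine f -> diff k (avg i j f) z =
  diff k f z - 2^-1 * (diff i (diff k f) z + diff j (diff k f) z).
Proof.
move=> hf; rewrite -avgE //; last exact: multiaffine_diff.
by rewrite /diff /avg ![bump (bump z k _) _ _]bumpC; ring.
Qed.

(** Since [d_i ^ 2 = d_j ^ 2 = 0], the operator [d_i d_j] annihilates the correction term
    [(d_i f + d_j f) / 2]. *)
Lemma diff2_avg f i j z : multiaffine f ->
  diff i (diff j (avg i j f)) z = diff i (diff j f) z.
Proof.
move=> hf; have hfj := multiaffine_diff j hf.
have E y : diff j (avg i j f) y = diff j f y - 2^-1 * diff i (diff j f) y.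
  by rewrite diff_avg // (diff_diag j) // addr0.
rewrite (_ : diff i _ z = diff j (avg i j f) (bump z i 1) - diff j (avg i j f) z) //.
by rewrite !E diff_bump // (hfj z i); ring.
Qed.

End Multiaffine.

(** * Rayleigh's inequality and barrier functions on real points *)

Definition lew (K : realFieldType) (I : eqType) (x y : I -> K) := forall i, x i <= y i.

(** The barrier method's notion of a point lying above all zeros of [g]. *)
Definition above (K : realFieldType) (I : eqType) (g : (I -> K) -> K) (x : I -> K) :=
  forall y, lew x y -> 0 < g y.

Definition rayleigh (K : realFieldType) (I : eqType) (g : (I -> K) -> K) :=
  forall (x : I -> K) i j, i != j ->
  g x * diff i (diff j g) x <= diff i g x * diff j g x.

Section Real.
Variables (K : realFieldType) (I : finType).
Implicit Types (x y : I -> K) (i j k : I) (g : (I -> K) -> K) (a b c s t u : K).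

Lemma lew_refl x : lew x x. Proof. by move=> i. Qed.

Lemma lew_trans x y z : lew x y -> lew y z -> lew x z.
Proof. by move=> h1 h2 i; apply: le_trans (h1 i) (h2 i). Qed.

Lemma lew_bump x i s : 0 <= s -> lew x (bump x i s).
Proof. by move=> s0 j; rewrite /bump; case: ifP => // _; rewrite lerDl. Qed.

Lemma lew_bumpW x y i s : lew (bump x i (- s)) y -> lew x (bump y i s).
Proof.
move=> h j; move: (h j); rewrite /bump; case: ifP => // _.
by rewrite lerBlDr.
Qed.

(** The path from [x] to [y] raises one coordinate at a time. *)
Lemma lew_ind (Q : (I -> K) -> Prop) :
  (forall x i s, 0 <= s -> Q x -> Q (bump x i s)) ->
  forall x y, lew x y -> Q x -> Q y.
Proof.
move=> hQ x y hxy Qx.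
pose w (s : seq I) := fun j => if j \in s then y j else x j.
have h (s : seq I) : uniq s -> Q (w s).
  elim: s => [_|i s IH /= /andP[nis us]];
    first by have -> : w [::] = x by apply: funext.
  have -> : w (i :: s) = bump (w s) i (y i - x i).
    apply: funext => j; rewrite /bump /w inE; case: eqP => [->|_] //=.
    by rewrite (negbTE nis) subrKC.
  by apply: hQ; [rewrite subr_ge0 | exact: IH].
have := h (enum I) (enum_uniq I).
by have -> : w (enum I) = y by apply: funext => j; rewrite /w mem_enum.
Qed.

Lemma above_le g x y : lew x y -> above g x -> above g y.
Proof. by move=> xy gx z yz; apply: gx; apply: lew_trans yz. Qed.

Lemma affine_slope_ge0 (a b : K) : (forall s, 0 <= s -> 0 <= a + s * b) -> 0 <= b.
Proof.
move=> h; rewrite leNgt; apply/negP => b0.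
have a0 : 0 <= a by have := h 0 (lexx _); rewrite mul0r addr0.
have nb : 0 < - b by rewrite oppr_gt0.
(* At this value of [s] the affine function equals [-1]. *)
have s0 : 0 <= (a + 1) / - b by rewrite divr_ge0 ?addr_ge0 ?ler01 // ltW.
by have := h _ s0; rewrite invrN mulrN mulNr divfK ?lt_eqF //; lra.
Qed.

Lemma above_diff_ge0 g x i y : multiaffine g -> above g x -> lew x y -> 0 <= diff i g y.
Proof.
move=> hg gx xy; apply: (@affine_slope_ge0 (g y)) => s s0; rewrite -hg ltW //.
by apply: gx; apply: lew_trans xy (lew_bump _ _ s0).
Qed.

Lemma above_diff2_ge0 g x i j y : multiaffine g -> above g x -> lew x y ->
  0 <= diff i (diff j g) y.
Proof.
move=> hg gx xy; apply: (@affine_slope_ge0 (diff j g y)) => s s0.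
rewrite -(multiaffine_diff _ hg) (above_diff_ge0 _ hg gx) //.
exact: lew_trans xy (lew_bump _ _ s0).
Qed.

(* Rayleigh's inequality says exactly that each barrier function
   [diff i g / g] is nonincreasing. *)
Lemma barrier_mono g x y i c : multiaffine g -> rayleigh g -> above g x -> lew x y ->
  diff i g x <= c * g x -> diff i g y <= c * g y.
Proof.
move=> hg hR gx xy hx.
suff [] : above g y /\ diff i g y <= c * g y by [].
apply: (@lew_ind (fun x => above g x /\ diff i g x <= c * g x)) xy _ => //.
move=> {x gx hx y} x j s s0 [gx hx]; have xx := lew_refl x.
split; first exact: above_le (lew_bump _ _ s0) gx.
have g0 := gx _ xx; have d0 := above_diff_ge0 j hg gx xx.
have di0 := above_diff_ge0 i hg gx xx.
have c0 : 0 <= c by rewrite -(pmulr_lge0 _ g0) (le_trans _ hx).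
have [->|ji] := eqVneq j i.
  rewrite diff_bump // (le_trans hx) // ler_wpM2l //.
  by rewrite hg lerDl mulr_ge0.
rewrite hg (multiaffine_diff _ hg) [c * _]mulrDr; apply: lerD => //.
rewrite mulrCA; apply: ler_wpM2l => //.
(* After multiplication by [g x > 0], Rayleigh bounds the mixed term by [d_j g * d_i g], to which
   the bound at [x] applies. *)
rewrite -(ler_pM2l g0); apply: (le_trans (hR x j i ji)).
have -> : g x * (c * diff j g x) = diff j g x * (c * g x) by ring.
by apply: ler_wpM2l.
Qed.

(** Positivity of the average at [x] forces [d_k g < g] there for [k = i] or [k = j]. The barrier of
    that [k] only decreases above [x], so [g - d_k g], which is [g] with coordinate [k] lowered by
    one, stays positive. *)
Lemma avg_selection g x i j : i != j -> multiaffine g -> rayleigh g ->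
  above (avg i j g) x -> above g (bump x i (-1)) \/ above g (bump x j (-1)).
Proof.
move=> ij hg hR Tx.
have u2 : (2 : K) != 0 by rewrite pnatr_eq0.
have hT := multiaffine_avg i j hg.
(* With [T = avg i j g], one has [g = T + (d_i T + d_j T) / 2 + d_i d_j T / 2], and the differences
   of [T] are nonnegative above [x]. *)
have gx : above g x.
  move=> y xy; have := Tx y xy.
  have := above_diff_ge0 i hT Tx xy; have := above_diff_ge0 j hT Tx xy.
  have := above_diff2_ge0 i j hT Tx xy.
  rewrite diff2_avg // !diff_avg // !diff_diag // avgE // (diffC _ j i).
  by lra.
have key k : diff k g x < g x -> above g (bump x k (-1)).
  move=> hk y /lew_bumpW xy; have g0 := gx _ (lew_refl x).
  have -> : y = bump (bump y k 1) k (-1) by rewrite bumpD subrr bump0.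
  rewrite hg; have := @barrier_mono g x _ k (diff k g x / g x) hg hR gx xy.
  rewrite divfK ?gt_eqF // => /(_ (lexx _)) h.
  have: diff k g x / g x * g (bump y k 1) < g (bump y k 1).
    by rewrite gtr_pMl ?ltr_pdivrMr ?mul1r //; apply: gx.
  by rewrite mulN1r subr_gt0; apply: le_lt_trans.
have := Tx _ (lew_refl x); rewrite avgE // => h.
case: (ltP (diff i g x) (g x)) => hi; first by left; apply: key.
by right; apply: key; lra.
Qed.

(* [A, B, C] and [A', B', C'] are the Taylor coefficients at [x + s(e_i + e_j)]
   of [g] and [diff k g] along [e_i + e_j]; the third hypothesis is the sign of
   the Wronskian, and the conclusion is the tangent-line (convexity) inequality
   for [diff k g / g] between that point and [x]. *)
Lemma wronskian_tangent (A B C A' B' C' s : K) :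
  0 < A -> 0 <= B -> 0 <= C -> 0 < s ->
  (forall t, (B' + 2 * C' * t) * (A + B * t + C * t ^+ 2)
             <= (A' + B' * t + C' * t ^+ 2) * (B + 2 * C * t)) ->
  0 < A - B * s + C * s ^+ 2 -> 0 <= B - 2 * C * s ->
  (A' * A + s * (A' * B - A * B')) * (A - B * s + C * s ^+ 2)
    <= A ^+ 2 * (A' - B' * s + C' * s ^+ 2).
Proof.
move=> A0 B0 C0 s0 hW hD hD'.
set w := A' * B - A * B'; pose y := A' * C - A * C'.
(* The Wronskian hypothesis times [A], as a quadratic in [t]. *)
have hWA t : 0 <= A * w + 2 * A * y * t + (B * y - C * w) * t ^+ 2.
  have -> : A * w + 2 * A * y * t + (B * y - C * w) * t ^+ 2 =
    A * ((A' + B' * t + C' * t ^+ 2) * (B + 2 * C * t)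
       - (B' + 2 * C' * t) * (A + B * t + C * t ^+ 2)).
    by rewrite /w /y; ring.
  by rewrite mulr_ge0 ?subr_ge0 // ltW.
have w0 : 0 <= w.
  have := hWA 0; rewrite mulr0 expr0n mulr0 !addr0 => h.
  by rewrite -(pmulr_rge0 _ A0).
(* The two sides of the goal differ by [s ^+ 2] times the slack in this inequality. *)
suff key : A * y <= w * (B - s * C).
  rewrite -subr_ge0.
  have -> : A ^+ 2 * (A' - B' * s + C' * s ^+ 2) -
    (A' * A + s * w) * (A - B * s + C * s ^+ 2) =
    s ^+ 2 * (w * (B - s * C) - A * y).
    by rewrite /w /y; ring.
  by rewrite mulr_ge0 ?exprn_ge0 ?subr_ge0 // ltW.
have hC : 0 <= s * C by rewrite mulr_ge0 // ltW.
case: (leP y 0) => y0.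
  rewrite (@le_trans _ _ 0) //; first by rewrite pmulr_rle0.
  by rewrite mulr_ge0 //; move: hD' hC; rewrite -mulrA [C * s]mulrC; lra.
have yn0 : y != 0 by rewrite gt_eqF.
have [w00|wn0] := eqVneq w 0.
  (* With [w = 0 < y] the quadratic is negative at [-1] if [B = 0], and at [- (A / B)] otherwise. *)
  exfalso; have [B00|Bn0] := eqVneq B 0.
    have := hWA (-1); rewrite w00 B00.
    have -> : A * 0 + 2 * A * y * -1 + (0 * y - C * 0) * (-1) ^+ 2 = - (2 * A * y)
      by ring.
    by rewrite oppr_ge0 leNgt !mulr_gt0.
  have := hWA (- (A / B)); rewrite w00 !(mulr0, add0r, subr0).
  have -> : 2 * A * y * - (A / B) + B * y * (- (A / B)) ^+ 2 = - (A ^+ 2 * y / B).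
    by field.
  rewrite oppr_ge0 leNgt divr_gt0 ?mulr_gt0 //.
  by rewrite lt_def Bn0.
have wp : 0 < w by rewrite lt_def wn0.
(* Taking [t = - u] in [hWA] shows that [A - B * u + C * u ^+ 2] is nonpositive. The same expression
   is positive at [s] and nonincreasing up to [s], hence [s <= u]. *)
pose u := w / y; have u0 : 0 < u by rewrite divr_gt0.
have wE : w = u * y by rewrite /u divfK.
have hu : A - B * u + C * u ^+ 2 <= 0.
  have := hWA (- u); rewrite {1 2}wE.
  have -> : A * (u * y) + 2 * A * y * - u + (B * y - C * (u * y)) * (- u) ^+ 2
    = - (u * y * (A - B * u + C * u ^+ 2)) by ring.
  by rewrite oppr_ge0 pmulr_rle0 // mulr_gt0.
have su : s <= u.
  rewrite leNgt; apply/negP => us.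
  have : 0 <= (s - u) * (B - C * (u + s)).
    apply: mulr_ge0; first by rewrite subr_ge0 ltW.
    apply: (le_trans hD'); rewrite lerD2l lerN2 [2 * C]mulrC -mulrA.
    by apply: ler_wpM2l => //; lra.
  have -> : (s - u) * (B - C * (u + s)) =
    (A - B * u + C * u ^+ 2) - (A - B * s + C * s ^+ 2) by ring.
  by lra.
have : A <= u * (B - C * u).
  by rewrite -subr_le0 (le_trans _ hu) // le_eqVlt; apply/orP; left; apply/eqP; ring.
move=> hA; rewrite wE mulrAC ler_wpM2r ?(ltW y0) // (le_trans hA) //.
by rewrite ler_wpM2l ?(ltW u0) // lerD2l lerN2 mulrC ler_wpM2l.
Qed.

Definition bump2 x i j s := bump (bump x i s) j s.

Lemma bump2E g x i j t : multiaffine g ->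
  g (bump2 x i j t) = g x + (diff i g x + diff j g x) * t
    + diff i (diff j g) x * t ^+ 2.
Proof.
by move=> hg; rewrite /bump2 hg diffC [diff j g _](multiaffine_diff _ hg) hg
  -diffC; ring.
Qed.

Lemma diff_bump2l g x i j t : multiaffine g ->
  diff i g (bump2 x i j t) = diff i g x + diff i (diff j g) x * t.
Proof.
by move=> hg; rewrite /bump2 (multiaffine_diff _ hg) diff_bump //
  [diff j (diff i g) _]diffC diff_bump; [ring|exact: multiaffine_diff].
Qed.

Lemma bump2C x i j t : bump2 x i j t = bump2 x j i t.
Proof. exact: bumpC. Qed.

Lemma bump2K x i j t : bump2 (bump2 x i j t) i j (- t) = x.
Proof. by rewrite /bump2 (bumpC _ j i) !bumpD subrr !bump0. Qed.

(** With [A], [B], [A'], [B'] as in [wronskian_tangent] and [w = A' * B - A * B'], averaging at the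
    shifted point raises the barrier of [k] by exactly [w / (2 * A * (A - B / 2))]. By convexity the
    shift by [s] has lowered it by at least [s * w / A ^+ 2]. As [A - B / 2] is at least
    [(1 - c) * A], the condition [2^-1 <= s * (1 - c)] makes the gain cover the loss. *)
Lemma avg_barrier g x i j c s : i != j -> multiaffine g -> rayleigh g -> above g x ->
  diff i g x <= c * g x -> diff j g x <= c * g x ->
  0 < s -> 2^-1 <= s * (1 - c) ->
  above (avg i j g) (bump2 x i j s) /\
  forall k u, k != i -> k != j -> diff k g x <= u * g x ->
    diff k (avg i j g) (bump2 x i j s) <= u * avg i j g (bump2 x i j s).
Proof.
move=> ij hg hR gx hi hj s0 hs; have u2 : (2 : K) != 0 by rewrite pnatr_eq0.
have c1 : 0 < 1 - c by rewrite -(pmulr_rgt0 _ s0); lra.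
have xx' : lew x (bump2 x i j s).
  by apply: lew_trans (lew_bump _ _ (ltW s0)) (lew_bump _ _ (ltW s0)).
have avg_ge y : lew x y -> (1 - c) * g y <= avg i j g y.
  move=> xy; rewrite avgE //.
  by have := barrier_mono hg hR gx xy hi; have := barrier_mono hg hR gx xy hj; lra.
split.
  move=> y x'y; have xy := lew_trans xx' x'y.
  by apply: lt_le_trans (avg_ge _ xy); rewrite mulr_gt0 // gx.
move=> k u ki kj hk; set x' := bump2 x i j s.
have hdk := multiaffine_diff k hg.
rewrite diff_avg // avgE //.
have B2 t : diff i g (bump2 x' i j t) + diff j g (bump2 x' i j t) =
    diff i g x' + diff j g x' + 2 * diff i (diff j g) x' * t.
  by rewrite (bump2C _ i j) diff_bump2l // (bump2C _ j i) diff_bump2l //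
    (diffC _ j i); ring.
have B2' t : diff i (diff k g) (bump2 x' i j t) + diff j (diff k g) (bump2 x' i j t) =
    diff i (diff k g) x' + diff j (diff k g) x' + 2 * diff i (diff j (diff k g)) x' * t.
  by rewrite (bump2C _ i j) diff_bump2l // (bump2C _ j i) diff_bump2l //
    (diffC _ j i); ring.
(* The sum of Rayleigh's inequalities for the pairs [(i, k)] and [(j, k)] along the line through
   [x'] in direction [e_i + e_j]. *)
have W t : (diff i (diff k g) x' + diff j (diff k g) x'
      + 2 * diff i (diff j (diff k g)) x' * t)
    * g (bump2 x' i j t) <= diff k g (bump2 x' i j t) *
    (diff i g x' + diff j g x' + 2 * diff i (diff j g) x' * t).
  rewrite -B2 -B2'; have := hR (bump2 x' i j t) i k; have := hR (bump2 x' i j t) j k.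
  rewrite ![_ == k]eq_sym => /(_ kj) h1 /(_ ki) h2; lra.
(* Going back by [s] from [x'] returns to [x], which expresses the values at [x] through the Taylor
   coefficients at [x']. *)
have := bump2E x' i j (- s) hg; have := B2 (- s); have := bump2E x' i j (- s) hdk.
rewrite /x' bump2K -/x' => EN EB ED.
have A0 : 0 < g x' by apply: gx.
have g0 := gx _ (lew_refl x).
have B0 : 0 <= diff i g x' + diff j g x'
  by rewrite addr_ge0 // (above_diff_ge0 _ hg gx).
have C0 : 0 <= diff i (diff j g) x' by apply: above_diff2_ge0 gx xx'.
have w0 : (diff i (diff k g) x' + diff j (diff k g) x') * g x' <=
    diff k g x' * (diff i g x' + diff j g x').
  by have := W 0; rewrite !mulr0 !addr0 /bump2 !bump0.
have := barrier_mono hg hR gx xx' hi; have := barrier_mono hg hR gx xx' hj.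
have WW : forall t, (diff i (diff k g) x' + diff j (diff k g) x'
      + 2 * diff i (diff j (diff k g)) x' * t)
    * (g x' + (diff i g x' + diff j g x') * t + diff i (diff j g) x' * t ^+ 2) <=
    (diff k g x' + (diff i (diff k g) x' + diff j (diff k g) x') * t
      + diff i (diff j (diff k g)) x' * t ^+ 2) *
    (diff i g x' + diff j g x' + 2 * diff i (diff j g) x' * t).
  by move=> t; have := W t; rewrite (bump2E _ _ _ _ hg) (bump2E _ _ _ _ hdk).
move: (wronskian_tangent A0 B0 C0 s0 WW).
have EB' : diff i g x' + diff j g x' - 2 * diff i (diff j g) x' * s
    = diff i g x + diff j g x.
  by rewrite EB; ring.
have ED' : g x' - (diff i g x' + diff j g x') * s + diff i (diff j g) x' * s ^+ 2 = g x.
  by rewrite ED; ring.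
have EN' : diff k g x' - (diff i (diff k g) x' + diff j (diff k g) x') * s
   + diff i (diff j (diff k g)) x' * s ^+ 2 = diff k g x.
  by rewrite EN; ring.
rewrite EB' ED' EN' => /(_ g0 (addr_ge0 (above_diff_ge0 i hg gx (lew_refl x))
  (above_diff_ge0 j hg gx (lew_refl x)))).
clear -A0 g0 w0 hs s0 hk c1.
move: (g x') (g x) (diff k g x') (diff k g x) (diff i (diff k g) x'
  + diff j (diff k g) x') (diff i g x') (diff j g x') A0 g0 w0 hk.
move=> A gx A' kx B' Bi Bj A0 g0 w0 hk key hBj hBi.
pose w := A' * (Bi + Bj) - A * B'.
have w0' : 0 <= w by rewrite subr_ge0 mulrC.
have key' : A' * A + s * w <= u * A ^+ 2.
  rewrite -(ler_pM2r g0); apply: (le_trans key).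
  have -> : u * A ^+ 2 * gx = A ^+ 2 * (u * gx) by ring.
  by rewrite ler_wpM2l // exprn_ge0 // ltW.
have T0 : 2^-1 * A <= s * (A - 2^-1 * (Bi + Bj)).
  apply: (@le_trans _ _ (s * (1 - c) * A)); first by rewrite ler_wpM2r // ltW.
  by rewrite -mulrA (ler_wpM2l (ltW s0)) //; lra.
have T1 : 0 <= A - 2^-1 * (Bi + Bj) by rewrite -(pmulr_rge0 _ s0); lra.
rewrite -(ler_pM2l A0) -(ler_pM2l A0).
have h1 := ler_wpM2r T1 key'; have h2 := ler_wpM2r w0' T0.
have -> : A * (A * (A' - 2^-1 * B')) =
    A * A' * (A - 2^-1 * (Bi + Bj)) + 2^-1 * A * w by rewrite /w; ring.
have -> : A * (A * (u * (A - 2^-1 * (Bi + Bj)))) =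
    u * A ^+ 2 * (A - 2^-1 * (Bi + Bj)) by ring.
apply: le_trans h1.
have -> : (A' * A + s * w) * (A - 2^-1 * (Bi + Bj)) =
    A * A' * (A - 2^-1 * (Bi + Bj)) + s * (A - 2^-1 * (Bi + Bj)) * w by ring.
by rewrite lerD2l.
Qed.

End Real.

(** * Stable multiaffine functions *)

(** Continuity at [0], obtained algebraically from a bound on the quotient [q] over the unit
    disk. *)
Lemma horner0_le0 (K : realFieldType) (p : {poly K}) :
  (forall t, 0 < t -> p.[t] <= 0) -> p.[0] <= 0.
Proof.
elim/poly_ind: p => [|q c _] h; first by rewrite horner0.
rewrite hornerMXaddC mulr0 add0r leNgt; apply/negP => c0.
have [M hM] := poly_disk_bound q 1.
have M0 : 0 <= M by apply: le_trans (hM 0 _); rewrite ?normr0.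
have cM : 0 < c + M + 1 by lra.
(* Small enough that [t <= 1] and [c - M * t] is still positive. *)
pose t := c / (c + M + 1); have t0 : 0 < t by rewrite divr_gt0.
have t1 : t <= 1 by rewrite ler_pdivrMr ?mul1r //; lra.
have := h t t0; rewrite hornerMXaddC leNgt => /negP; apply.
have hq : - M <= q.[t].
  by have := hM t; rewrite (ger0_norm (ltW t0)) => /(_ t1);
    rewrite ler_norml => /andP[].
apply: (@lt_le_trans _ _ (- M * t + c)); last by rewrite lerD2r (ler_wpM2r (ltW t0)).
have -> : - M * t + c = c * (c + 1) / (c + M + 1) by rewrite /t; field; rewrite gt_eqF.
by rewrite divr_gt0 // mulr_gt0 //; lra.
Qed.

Section Stable.
Variables (K : rcfType) (I : finType).
Local Notation C := K[i].
Implicit Types (f : (I -> C) -> C) (x y : I -> K) (z w : I -> C) (i j k : I).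

Definition emb x : I -> C := fun i => (x i)%:C.

Definition rpart f x : K := complex.Re (f (emb x)).

(** The multiaffine real stable polynomials, viewed as functions. *)
Record stable f : Prop := Stable {
  stable_multiaffine : multiaffine f;
  stable_real : forall x, complex.Im (f (emb x)) = 0;
  stable_neq0 : forall z, (forall i, 0 < complex.Im (z i)) -> f z != 0 }.

Lemma emb_bump x i s : emb (bump x i s) = bump (emb x) i s%:C.
Proof. by apply: funext => j; rewrite /emb /bump; case: ifP => // _;
  rewrite rmorphD. Qed.

Lemma rpart_diff f i : rpart (diff i f) = diff i (rpart f).
Proof. by apply: funext => x; rewrite /rpart /diff emb_bump;
  case: (f _) (f _) => [? ?] []. Qed.

Lemma rpart_avg f i j : rpart (avg i j f) = avg i j (rpart f).
Proof.
apply: funext => x; rewrite /rpart /avg !emb_bump.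
have -> : (2^-1 : C) = (2^-1)%:C by rewrite fmorphV rmorph_nat.
rewrite !rmorphN rmorph1.
by case: (f _) (f _) => [a b] [c d] /=; rewrite mul0r subr0.
Qed.

Lemma multiaffine_rpart f : multiaffine f -> multiaffine (rpart f).
Proof.
move=> hf x i s; rewrite -rpart_diff /rpart emb_bump hf.
by case: (f _) (diff _ _ _) => [a b] [c d] /=; rewrite mul0r subr0.
Qed.

(** For [b != 0] the root [- a / b] has imaginary part [Im (b * conjc a) / |b| ^ 2], which must be
    negative. *)
Lemma halfplane_slope (a b : C) : (forall s : C, 0 <= complex.Im s -> a + s * b != 0) ->
  [/\ a != 0, complex.Im (b * conjc a) <= 0 & (complex.Im (b * conjc a) = 0 -> b = 0)].
Proof.
move=> h.
have a0 : a != 0 by have := h 0 (lexx _); rewrite mul0r addr0.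
suff hb : b != 0 -> complex.Im (b * conjc a) < 0.
  have [b0|/hb hlt] := eqVneq b 0; first by split=> //; rewrite b0 mul0r.
  by split=> //; [exact: ltW | move=> e; rewrite e ltxx in hlt].
move=> b0; rewrite ltNge; apply/negP => hge.
case: a a0 h hge => a1 a2 _; case: b b0 => b1 b2 b0 h /= hge.
have n0 : 0 < b1 ^+ 2 + b2 ^+ 2.
  rewrite lt_def addr_ge0 ?sqr_ge0 // andbT paddr_eq0 ?sqr_ge0 // !sqrf_eq0.
  by move: b0; rewrite eq_complex.
have n0' : b1 ^+ 2 + b2 ^+ 2 != 0 by rewrite gt_eqF.
(* The root [- a / b] in real coordinates. *)
have := h (- ((a1 * b1 + a2 * b2) / (b1 ^+ 2 + b2 ^+ 2))
  +i* ((b2 * a1 - b1 * a2) / (b1 ^+ 2 + b2 ^+ 2))) => /=.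
have -> : b2 * a1 - b1 * a2 = b1 * - a2 + b2 * a1 by ring.
rewrite divr_ge0 ?(ltW n0) // => /(_ isT) /negP; apply.
by rewrite eq_complex /=; apply/andP; split; apply/eqP; field.
Qed.

Lemma stable_slope f z i : stable f -> (forall j, 0 < complex.Im (z j)) ->
  [/\ f z != 0, complex.Im (diff i f z * conjc (f z)) <= 0
    & (complex.Im (diff i f z * conjc (f z)) = 0 -> diff i f z = 0)].
Proof.
move=> [hf _ h0] hz; apply: halfplane_slope => s s0.
rewrite -hf; apply: h0 => j; rewrite /bump; case: ifP => // _.
by rewrite raddfD /= ltr_wpDr.
Qed.

(** At a zero of the average [2 f = d_i f + d_j f]. After multiplication by [conjc f] the left side
    is real, while both terms on the right have nonpositive imaginary part. So both imaginary parts
    vanish, hence both slopes, hence [f] itself. *)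
Lemma stable_avg f i j : stable f -> stable (avg i j f).
Proof.
move=> hs; have [hf hr h0] := hs; split.
- exact: multiaffine_avg.
- move=> x; rewrite /avg.
  have -> : (2^-1 : C) = (2^-1)%:C by rewrite fmorphV rmorph_nat.
  have -> : (-1 : C) = (-1)%:C by rewrite rmorphN rmorph1.
  rewrite -!emb_bump; move: (hr (bump x i (-1))) (hr (bump x j (-1))).
  by case: (f _) (f _) => [a b] [c d] /= -> ->; rewrite addr0 mulr0 mul0r addr0.
- move=> z hz; apply/eqP; rewrite avgE ?pnatr_eq0 // => /eqP.
  have [nz i1 i2] := stable_slope i hs hz; have [_ j1 j2] := stable_slope j hs hz.
  rewrite subr_eq0 => /eqP e.
  have e2 : 2 * (f z * conjc (f z)) =
      diff i f z * conjc (f z) + diff j f z * conjc (f z).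
    by rewrite {1}e !mulrA divff ?pnatr_eq0 // mul1r mulrDl.
  have : complex.Im (2 * (f z * conjc (f z))) = 0.
    by case: (f z) => a b /=; ring.
  rewrite e2 raddfD /= => e3.
  have ei : diff i f z = 0 by apply: i2; apply/eqP; rewrite eq_le i1 /=; lra.
  have ej : diff j f z = 0 by apply: j2; apply/eqP; rewrite eq_le j1 /=; lra.
  by move: nz; rewrite e ei ej addr0 mulr0 eqxx.
Qed.

(** Provides polynomials in a real parameter, so that limits to real points can be taken with
    [horner0_le0]. *)
Lemma multiaffine_line f z w : multiaffine f ->
  exists p q : {poly K}, forall t, f (fun j => z j + t%:C * w j) = p.[t] +i* q.[t].
Proof.
move=> hf.
suff h (s : seq I) : uniq s -> forall z, exists p q : {poly K}, forall t,
    f (fun j => z j + (if j \in s then t%:C * w j else 0)) = p.[t] +i* q.[t].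
  have [p [q hpq]] := h (enum I) (enum_uniq I) z; exists p, q => t; rewrite -hpq.
  by congr f; apply: funext => j; rewrite mem_enum.
elim: s {z} => [_ z|i s IH /= /andP[nis us] z].
  exists (complex.Re (f z))%:P, (complex.Im (f z))%:P => t; rewrite !hornerC.
  have -> : (fun j => z j + (if j \in [::] then t%:C * w j else 0)) = z.
    by apply: funext => j; rewrite addr0.
  by case: (f z).
have [p1 [q1 h1]] := IH us z; have [p2 [q2 h2]] := IH us (bump z i 1).
case ew : (w i) => [a b].
exists (p1 + 'X * (a%:P * (p2 - p1) - b%:P * (q2 - q1))),
  (q1 + 'X * (a%:P * (q2 - q1) + b%:P * (p2 - p1))) => t.
pose y j := z j + (if j \in s then t%:C * w j else 0).
have -> : (fun j => z j + (if j \in i :: s then t%:C * w j else 0)) =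
    bump y i (t%:C * w i).
  apply: funext => j; rewrite /bump /y inE; case: eqP => [->|_] //=.
  by rewrite (negbTE nis) addr0.
have e2 : bump y i 1 = fun j => bump z i 1 j + (if j \in s then t%:C * w j else 0).
  by apply: funext => j; rewrite /bump /y; case: eqP => // _; rewrite addrAC.
rewrite hf /diff e2 h2 h1 ew !hornerE.
by apply/eqP; rewrite eq_complex /=; apply/andP; split; apply/eqP; ring.
Qed.

Lemma diff_real f i : (forall x, complex.Im (f (emb x)) = 0) ->
  forall x, complex.Im (diff i f (emb x)) = 0.
Proof.
have E x : bump (emb x) i 1 = emb (bump x i 1) by rewrite emb_bump rmorph1.
by move=> hr x; rewrite /diff E raddfB /= !hr subrr.
Qed.

(** At [x + 'i e_j + t 'i (1, ..., 1)] with [t > 0], stability gives [Im (d_i f * conjc f) <= 0]. As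
    [t] tends to [0], [f] becomes [f x + 'i d_j f x] and [d_i f] becomes [d_i f x + 'i d_i d_j f x],
    so the limit inequality is Rayleigh's. *)
Lemma stable_rayleigh f : stable f -> rayleigh (rpart f).
Proof.
move=> hs x i j ij; have [hf hr _] := hs.
have hfi := multiaffine_diff i hf.
pose z0 := bump (emb x) j 'i.
have [p1 [q1 h1]] := multiaffine_line z0 (fun=> 'i) hf.
have [p2 [q2 h2]] := multiaffine_line z0 (fun=> 'i) hfi.
pose p := q2 * p1 - p2 * q1.
have hp t : 0 < t -> p.[t] <= 0.
  move=> t0; pose z := fun k => z0 k + t%:C * 'i.
  have hz k : 0 < complex.Im (z k).
    rewrite /z /z0 /bump /emb /=; case: ifP => _ /=; simpc; lra.
  have [_ + _] := stable_slope i hs hz; rewrite h1 h2 /= /p !hornerE.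
  by apply: le_trans; rewrite le_eqVlt; apply/orP; left; apply/eqP; ring.
have := horner0_le0 hp; rewrite /p !hornerE.
have hz0 : (fun k => z0 k + 0%:C * 'i) = z0.
  by apply: funext => k; rewrite mul0r addr0.
move: (h1 0) (h2 0); rewrite hz0 {1 2}/z0 => e1 e2.
move: e1 e2; rewrite hf (multiaffine_diff i hf).
rewrite -!rpart_diff /rpart (diffC f i j).
move: (hr x) (diff_real i hr x) (diff_real j hr x) (diff_real j (diff_real i hr) x).
case: (f (emb x)) (diff i f (emb x)) (diff j f (emb x)) (diff j (diff i f) (emb x)).
move=> a ? [b ?] [c ?] [d ?] /= -> -> -> -> [<- <-] [<- <-].
lra.
Qed.

End Stable.

(** * Averaging over all pairs and undoing the averages *)

Section Selection.
Variables (K : rcfType) (L : finType).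
Local Notation I := (bool * L)%type.
Local Notation C := K[i].
Implicit Types (f : (I -> C) -> C) (x : I -> K) (s : seq L) (l : L).

Definition pair_avg l f := avg (true, l) (false, l) f.

Definition pair_avgs s f := foldl (fun f l => pair_avg l f) f s.

(** Each average costs a shift by [t] in its own two coordinates and raises no barrier of a later
    pair, so the same [c] serves throughout. *)
Lemma pair_avgs_barrier s f x (c t : K) : uniq s -> stable f ->
  above (rpart f) x ->
  (forall b l, l \in s -> diff (b, l) (rpart f) x <= c * rpart f x) ->
  0 < t -> 2^-1 <= t * (1 - c) ->
  above (rpart (pair_avgs s f)) (fun k => x k + (if k.2 \in s then t else 0)).
Proof.
elim: s f x => [f x _ _ fx _ _ _|l s IH f x /= /andP[nls us] fs fx hc t0 ht].
  by rewrite (_ : (fun k => _) = x) //; apply: funext => k; rewrite addr0.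
have neq : (true, l) != (false, l) by [].
have hf := multiaffine_rpart (stable_multiaffine fs).
have [] := avg_barrier neq hf (stable_rayleigh fs) fx
  (hc true l (mem_head _ _)) (hc false l (mem_head _ _)) t0 ht.
rewrite -rpart_avg => ax hd.
set x' := bump2 _ _ _ _ in ax hd.
have -> : (fun k => x k + (if k.2 \in l :: s then t else 0)) =
    (fun k => x' k + (if k.2 \in s then t else 0)).
  apply: funext => -[b k]; rewrite /x' /bump2 /bump inE /= !xpair_eqE.
  case: (eqVneq k l) => [->|kl] /=; rewrite ?andbF //= ?andbT.
  by rewrite (negbTE nls) addr0; case: b.
apply: IH => //; first exact: stable_avg.
move=> b k ks; rewrite /pair_avg; apply: hd.
- by rewrite xpair_eqE; apply: contraNN nls => /andP[_ /eqP <-].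
- by rewrite xpair_eqE; apply: contraNN nls => /andP[_ /eqP <-].
- by apply: hc; rewrite inE ks orbT.
Qed.

(** The averages are undone from the last to the first; [tau] records the copy lowered in each
    pair. *)
Lemma pair_avgs_selection s f x : uniq s -> stable f ->
  above (rpart (pair_avgs s f)) x ->
  exists tau : L -> bool,
    above (rpart f) (fun k => x k - (if (k.2 \in s) && (k.1 == tau k.2) then 1 else 0)).
Proof.
elim: s f x => [f x _ _ fx|l s IH f x /= /andP[nls us] fs fx].
  exists (fun=> true); rewrite (_ : (fun k => _) = x) //.
  by apply: funext => k; rewrite subr0.
have [tau ht] := IH _ _ us (stable_avg (true, l) (false, l) fs) fx.
set y := (fun k => _) in ht.
have hf := multiaffine_rpart (stable_multiaffine fs).
have neq : (true, l) != (false, l) by [].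
have [b hb] : exists b, above (rpart f) (bump y (b, l) (-1)).
  move: ht; rewrite rpart_avg => /(avg_selection neq hf (stable_rayleigh fs)).
  by case=> h; [exists true | exists false].
exists (fun k => if k == l then b else tau k).
rewrite (_ : (fun k => _) = bump y (b, l) (-1)) //.
apply: funext => -[c k]; rewrite /y /bump inE /= xpair_eqE.
case: (eqVneq k l) => [->|kl] /=; last by rewrite andbF.
by rewrite (negbTE nls) /= subr0 andbT; case: (c == b); rewrite ?subr0.
Qed.

Lemma stable_selection f x (c t : K) : stable f -> above (rpart f) x ->
  (forall k, diff k (rpart f) x <= c * rpart f x) ->
  0 < t -> 2^-1 <= t * (1 - c) ->
  exists tau : L -> bool, above (rpart f) (fun k => x k + t - (k.1 == tau k.2)%:R).
Proof.
move=> fs fx hc t0 ht.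
have h := pair_avgs_barrier (enum_uniq L) fs fx (fun b l _ => hc (b, l)) t0 ht.
have [tau] := pair_avgs_selection (enum_uniq L) fs h.
set y := (fun k => _) => hy; exists tau.
have -> // : (fun k => x k + t - (k.1 == tau k.2)%:R) = y.
by apply: funext => k; rewrite /y !mem_enum /=; case: eqP.
Qed.

End Selection.

(** * Gram determinants *)

Section NormSquare.
Variable K : rcfType.
Implicit Types (c d : K[i]).

Lemma conjcM c d : conjc (c * d) = conjc c * conjc d.
Proof. exact: rmorphM. Qed.

Lemma conjcB c d : conjc (c - d) = conjc c - conjc d.
Proof. exact: rmorphB. Qed.

Definition nsq c : K := complex.Re c ^+ 2 + complex.Im c ^+ 2.

Lemma nsq_ge0 c : 0 <= nsq c.
Proof. by rewrite addr_ge0 ?sqr_ge0. Qed.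

Lemma mulcJ c : c * conjc c = (nsq c)%:C.
Proof. by case: c => a b; apply/eqP; rewrite eq_complex /nsq /=; apply/andP; split;
  apply/eqP; ring. Qed.

Lemma nsq_eq0 c : nsq c = 0 -> c = 0.
Proof.
move=> h; apply/eqP; have /eqP := mulcJ c.
by rewrite h mulf_eq0 conjc_eq0 orbb.
Qed.

(* The quadratic [r |-> |alpha - r F beta|_w^2], where [F] is the [w]-product
   of [alpha] and [beta]. *)
Lemma weighted_cauchy (T : finType) (w : T -> K) (al be : T -> K[i]) (r : K) :
  let f := nsq (\sum_k (w k)%:C * (al k * conjc (be k))) in
  (forall c, 0 <= \sum_k w k * nsq (al k - c * be k)) ->
  0 <= \sum_k w k * nsq (al k) - 2 * r * f + r ^+ 2 * f * \sum_k w k * nsq (be k).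
Proof.
set F := \sum_k _ => f /(_ (r%:C * F)); congr (_ <= _); apply: complexI.
rewrite raddfD raddfB /= !rmorphM /= rmorph_nat !raddf_sum /= -(mulcJ F).
have -> : r%:C * r%:C * (F * conjc F) * (\sum_i (w i * nsq (be i))%:C) =
   \sum_k r%:C * r%:C * (F * conjc F) * ((w k)%:C * (be k * conjc (be k))).
  by rewrite mulr_sumr; apply: eq_bigr => k _; rewrite rmorphM /= -mulcJ.
have -> : 2 * r%:C * (F * conjc F) =
  \sum_k (r%:C * conjc F * ((w k)%:C * (al k * conjc (be k))) +
     r%:C * F * ((w k)%:C * (be k * conjc (al k)))).
  rewrite big_split /= -!mulr_sumr -/F.
  have -> : \sum_k (w k)%:C * (be k * conjc (al k)) = conjc F.
    rewrite /F rmorph_sum /=; apply: eq_bigr => k _.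
    by rewrite !conjcM conjc_real conjcK [be k * _]mulrC.
  by ring.
rewrite -sumrB -big_split /=; apply: eq_bigr => k _.
rewrite !rmorphM /= -!mulcJ conjcB !conjcM conjc_real.
by ring.
Qed.

End NormSquare.

(** The determinant is that of the bordered matrix with rows [(M, w)] and [(- s v, 1)], where [s]
    occurs in the last row only. *)
Lemma det_rank_one (F : fieldType) n (M : 'M[F]_n) (w : 'cV[F]_n) (v : 'rV[F]_n) :
  exists d, forall s, \det (M + s *: (w *m v)) = \det M + s * d.
Proof.
exists (\det (block_mx M w (- v) 0)) => s.
pose B := block_mx M w (- (s *: v)) 1%:M.
have <- : \det B = \det (M + s *: (w *m v)).
  have : B *m block_mx 1%:M 0 (s *: v) 1%:M = block_mx (M + s *: (w *m v)) w 0 1%:M.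
    by rewrite mulmx_block !mulmx1 !mulmx0 !mul1mx !add0r addNr -scalemxAr.
  move/(congr1 determinant); rewrite det_mulmx det_lblock det_ublock !det1 !mulr1.
  by [].
have -> : \det M = \det (block_mx M w 0 1%:M) by rewrite det_ublock det1 mulr1.
rewrite -[\det (block_mx M w 0 _)]mul1r.
(* The last row is [(0, 1)] plus [s] times [(- v, 0)]. *)
apply: (determinant_multilinear (i0 := rshift n ord0)).
- rewrite scale1r !rowKd; apply/rowP => j; rewrite !mxE.
  by case: (fintype.split j) => k; rewrite !mxE; ring.
- by rewrite /B /block_mx !row'Kd ![row' ord0 _]flatmx0.
- by rewrite /B /block_mx !row'Kd ![row' ord0 _]flatmx0.
Qed.

Section Gram.
Variables (K : rcfType) (L : finType) (n : nat) (u : L -> 'rV[K[i]]_n).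
Local Notation C := K[i].
Implicit Types (x y : 'rV[C]_n) (z : L -> C) (w : L -> K) (l : L).

Definition adj x : 'cV[C]_n := (map_mx (@conjc K) x)^T.

Definition ip x y : C := \sum_i x 0 i * conjc (y 0 i).

Definition gram z : 'M[C]_n := \sum_l z l *: (adj (u l) *m u l).

Definition quad w x : K := \sum_l w l * nsq (ip x (u l)).

Definition posdef w := forall x, x != 0 -> 0 < quad w x.

Lemma mulmx_adj x y : (x *m adj y) 0 0 = ip x y.
Proof. by rewrite mxE; apply: eq_bigr => i _; rewrite !mxE. Qed.

Lemma ipC x y : ip x y = conjc (ip y x).
Proof.
rewrite /ip rmorph_sum /=; apply: eq_bigr => i _.
by rewrite conjcM conjcK mulrC.
Qed.

Lemma ip_subZ x y c v : ip (x - c *: y) v = ip x v - c * ip y v.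
Proof.
rewrite /ip mulr_sumr -sumrB; apply: eq_bigr => i _; rewrite !mxE; ring.
Qed.

Lemma mul_gram x z y : ((x *m gram z) *m adj y) 0 0 =
  \sum_l z l * (ip x (u l) * conjc (ip y (u l))).
Proof.
rewrite /gram mulmx_sumr mulmx_suml summxE; apply: eq_bigr => l _.
rewrite -scalemxAr -scalemxAl mxE; congr (_ * _).
rewrite mulmxA -[_ *m u l *m _]mulmxA mxE big_ord1 mulmx_adj mulmx_adj.
by rewrite -ipC.
Qed.

Lemma gram_bump z l s : gram (bump z l s) = gram z + s *: (adj (u l) *m u l).
Proof.
rewrite /gram (bigD1 l) //= (bigD1 l (P := xpredT)) //= /bump eqxx scalerDl.
rewrite addrAC; congr (_ + _ + _); apply: eq_bigr => k /negbTE kl.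
by rewrite kl.
Qed.

Lemma quad_bump w l s x : quad (bump w l s) x = quad w x + s * nsq (ip x (u l)).
Proof.
rewrite /quad (bigD1 l) //= [in RHS](bigD1 l) //= /bump eqxx mulrDl.
rewrite addrAC; congr (_ + _ + _); apply: eq_bigr => k /negbTE kl.
by rewrite kl.
Qed.

Lemma posdef_le w w' : lew w w' -> posdef w -> posdef w'.
Proof.
move=> h hw x x0; apply: lt_le_trans (hw x x0) _.
by apply: ler_sum => l _; rewrite ler_wpM2r ?nsq_ge0.
Qed.

Definition gram_det z : C := \det (gram z).

Lemma gram_det_eq0 z : gram_det z = 0 ->
  exists2 x, x != 0 & \sum_l z l * (nsq (ip x (u l)))%:C = 0.
Proof.
move/eqP/det0P => [x x0 hx]; exists x => //.
transitivity (((x *m gram z) *m adj x) 0 0); last by rewrite hx mul0mx mxE.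
by rewrite mul_gram; apply: eq_bigr => l _; rewrite mulcJ.
Qed.

Lemma multiaffine_gram_det : multiaffine gram_det.
Proof.
move=> z l s; have [d hd] := det_rank_one (gram z) (adj (u l)) (u l).
by rewrite /diff /gram_det !gram_bump !hd; ring.
Qed.

(** For real weights the Gram matrix is Hermitian. *)
Lemma gram_det_real w : complex.Im (gram_det (emb w)) = 0.
Proof.
have h : (map_mx (@conjc K) (gram (emb w)))^T = gram (emb w).
  apply/matrixP => i j; rewrite !mxE !summxE rmorph_sum /=.
  apply: eq_bigr => l _; rewrite !mxE !big_ord1 !mxE !conjcM conjc_real conjcK.
  by rewrite [u l 0 j * _]mulrC.
have : conjc (gram_det (emb w)) = gram_det (emb w).
  by rewrite -[in RHS]/(gram_det _) /gram_det -{2}h det_tr det_map_mx.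
by case: (gram_det _) => a b [] /= ; lra.
Qed.

Lemma posdef_det_neq0 w : posdef w -> rpart gram_det w != 0.
Proof.
move=> pd; apply/eqP => h.
have /gram_det_eq0[x x0 hx] : gram_det (emb w) = 0.
  by apply/eqP; rewrite eq_complex gram_det_real -/(rpart _ _) h /= !eqxx.
have := pd x x0; suff -> : quad w x = 0 by rewrite ltxx.
apply: (@complexI K); rewrite raddf0 /= -[RHS]hx /quad raddf_sum /=.
by apply: eq_bigr => l _; rewrite rmorphM.
Qed.

(** A kernel vector [x] makes the sum of [z_l |<x, u_l>|^2] vanish. Its imaginary part is a sum of
    nonnegative terms, so [x] is orthogonal to every [u_l], against positive definiteness. *)
Lemma stable_gram_det : posdef (fun=> 1) -> stable gram_det.
Proof.
move=> pd; split; [exact: multiaffine_gram_det | exact: gram_det_real |].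
move=> z hz; apply/eqP => /gram_det_eq0[x x0 hx].
have e : \sum_l complex.Im (z l) * nsq (ip x (u l)) = 0.
  transitivity (complex.Im (\sum_l z l * (nsq (ip x (u l)))%:C)); last by rewrite hx.
  rewrite raddf_sum /=; apply: eq_bigr => l _.
  by case: (z l) => a b /=; rewrite mulr0 add0r.
have hl l : nsq (ip x (u l)) = 0.
  have /psumr_eq0P h : forall l, true -> 0 <= complex.Im (z l) * nsq (ip x (u l)).
    by move=> k _; rewrite mulr_ge0 ?nsq_ge0 // ltW.
  by have /eqP := h e l isT; rewrite mulf_eq0 gt_eqF //= => /eqP.
by have := pd x x0; rewrite /quad big1 ?ltxx // => l _; rewrite hl mulr0.
Qed.

End Gram.

(** Otherwise the root [- a / d] would lie between [0] and [s]; the proof writes it with numerator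
    [a ^+ 2] to expose its sign. *)
Lemma affine_same_sign (K : realFieldType) (a d s : K) : 0 <= s ->
  (forall r, 0 <= r <= s -> a + r * d != 0) -> 0 < a * (a + s * d).
Proof.
move=> s0 h.
have ha : a != 0 by have := h 0; rewrite mul0r addr0 lexx; apply.
rewrite ltNge; apply/negP => hle.
have a2 : 0 < a ^+ 2 by rewrite lt_def sqr_ge0 sqrf_eq0 ha.
have had : s * (a * d) < 0.
  by move: hle; rewrite mulrDr -expr2 mulrCA; lra.
have s1 : 0 < s by rewrite lt_def s0 andbT; apply: contraTneq had => ->;
  rewrite mul0r ltxx.
have ad : a * d < 0 by move: had; rewrite pmulr_rlt0.
have d0 : d != 0 by apply: contraTneq ad => ->; rewrite mulr0 ltxx.
have := h (- (a ^+ 2 / (a * d))).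
have nad : 0 < - (a * d) by rewrite oppr_gt0.
rewrite -mulrN -invrN divr_ge0 ?sqr_ge0 ?(ltW nad) //= ler_pdivrMr //.
have -> : a ^+ 2 <= s * - (a * d) by move: hle; rewrite mulrDr -expr2 mulrCA; lra.
move/(_ isT)/negP; apply; apply/eqP; field.
by rewrite ha d0.
Qed.

(** * Positive definiteness and the sign of the Gram determinant *)

Section Split.
Variables (K : rcfType) (L : finType) (n : nat) (u : L -> 'rV[K[i]]_n).
Local Notation C := K[i].
Implicit Types (x y : 'rV[C]_n) (z : L -> C) (w : L -> K) (l : L).
Local Notation posdef := (posdef u).
Local Notation Q := (quad u).
Local Notation H := (rpart (gram_det u)).

Let multiaffine_H : multiaffine H.
Proof. exact: multiaffine_rpart (multiaffine_gram_det u). Qed.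

Lemma quad_sub w x y c :
  Q w (x - c *: y) = \sum_l w l * nsq (ip x (u l) - c * ip y (u l)).
Proof. by apply: eq_bigr => l _; rewrite ip_subZ. Qed.

Lemma quad0 w : Q w 0 = 0.
Proof.
rewrite /quad big1 // => l _; rewrite (_ : ip 0 _ = 0) /nsq /=; last first.
  by rewrite /ip big1 // => i _; rewrite mxE mul0r.
by rewrite expr0n addr0 mulr0.
Qed.

Lemma posdef_ge0 w x : posdef w -> 0 <= Q w x.
Proof. by move=> pd; have [->|/pd/ltW//] := eqVneq x 0; rewrite quad0. Qed.

(* If the form fails to stay positive definite at the end of the segment, then
   [y = u_l M^-1] is a kernel vector at an earlier point of it. *)
Lemma posdef_step w l : posdef w ->
  (forall r, 0 <= r <= 1 -> H (bump w l (- r)) != 0) -> posdef (bump w l (- 1)).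
Proof.
move=> pd hdet x x0; rewrite quad_bump mulN1r subr_gt0.
rewrite ltNge; apply/negP => hle.
pose M := gram u (emb w).
have uM : M \in unitmx.
  rewrite unitmxE unitfE; apply: contra (posdef_det_neq0 pd) => /eqP.
  by rewrite /rpart /gram_det -/M => ->.
pose y := u l *m invmx M; have yM : y *m M = u l by rewrite mulmxKV.
have e v : ip v (u l) = \sum_k (w k)%:C * (ip v (u k) * conjc (ip y (u k))).
  rewrite ipC -mulmx_adj -yM mul_gram rmorph_sum /=; apply: eq_bigr => k _.
  by rewrite !conjcM conjc_real conjcK [conjc _ * _]mulrC.
have qy : ip y (u l) = (Q w y)%:C.
  rewrite e /quad raddf_sum /=; apply: eq_bigr => k _.
  by rewrite mulcJ rmorphM.
have Q0 := pd x x0.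
have f0 : 0 < nsq (ip x (u l)) by apply: lt_le_trans hle.
have y0 : y != 0.
  apply: contraTneq f0 => y0; rewrite e y0 big1 => [|k _].
    by rewrite /nsq /= expr0n addr0 ltxx.
  by rewrite [ip 0 _](_ : _ = 0) ?conjc0 ?mulr0 // /ip big1 // => i _;
    rewrite mxE mul0r.
have B0 := pd y y0.
(* Cauchy-Schwarz for the form [Q w], since by [e] pairing with [u_l] is the [w]-product with
   [y]. *)
have key : nsq (ip x (u l)) <= Q w x * Q w y.
  have := @weighted_cauchy K L w (fun k => ip x (u k)) (fun k => ip y (u k)) (Q w y)^-1.
  move=> /= /(_ (fun c => _)); rewrite -e => h.
  have {h} := h _; have hc c : 0 <= \sum_k w k * nsq (ip x (u k) - c * ip y (u k)).
    by rewrite -quad_sub posdef_ge0.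
  move=> /(_ hc); rewrite -/(Q w x) -/(Q w y).
  rewrite -(pmulr_lge0 _ B0) => h; rewrite -subr_ge0; apply: le_trans h _.
  rewrite le_eqVlt; apply/orP; left; apply/eqP; field.
  by rewrite gt_eqF.
have B1 : 1 <= Q w y.
  by rewrite -(ler_pM2l Q0) mulr1; apply: le_trans key.
(* For this weight [y] is mapped to [u_l - u_l = 0], because [y M = u_l] and [ip y u_l = Q w y]. *)
have := hdet (Q w y)^-1; rewrite invr_ge0 (ltW B0) invf_le1 // B1 => /(_ isT).
case/negP; rewrite /rpart emb_bump /gram_det.
suff -> : \det (gram u (bump (emb w) l (- (Q w y)^-1)%:C)) = 0 by [].
apply/eqP/det0P; exists y => //.
rewrite gram_bump mulmxDr yM -scalemxAr mulmxA [y *m adj _]mx11_scalar mulmx_adj qy.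
rewrite mul_scalar_mx scalerA -rmorphM /= mulNr mulVf ?gt_eqF // rmorphN rmorph1.
by rewrite scaleN1r subrr.
Qed.

(** Raising weights preserves positive definiteness, so the determinant never vanishes on the way.
    The product with [H w0] expresses that its sign is constant without saying which sign it is. *)
Lemma gram_det_above w0 w : posdef w0 -> lew w0 w -> 0 < H w0 * H w.
Proof.
move=> pd hw.
suff [] : posdef w /\ 0 < H w0 * H w by [].
apply: (@lew_ind _ _ (fun w => posdef w /\ 0 < H w0 * H w)) hw _; last first.
  by split=> //; rewrite -expr2 lt_def sqr_ge0 sqrf_eq0 posdef_det_neq0.
move=> {}w l s s0 [pw hpos]; have pb r : 0 <= r -> posdef (bump w l r).
  by move=> r0; apply: posdef_le pw; exact: lew_bump.
split; first exact: pb.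
have := @affine_same_sign _ (H w) (diff l H w) s s0.
rewrite -multiaffine_H => h.
have : 0 < H w * H (bump w l s).
  by apply: h => r /andP[r0 _]; rewrite -multiaffine_H; apply: posdef_det_neq0;
    exact: pb.
have Hw : 0 < H w ^+ 2 by rewrite lt_def sqr_ge0 sqrf_eq0 (posdef_det_neq0 pw).
move=> h2; rewrite -(pmulr_lgt0 _ Hw).
have -> : H w0 * H (bump w l s) * H w ^+ 2 = (H w0 * H w) * (H w * H (bump w l s))
  by ring.
exact: mulr_gt0.
Qed.

End Split.

(** * Two independent copies of the variables *)

Section Product.
Variables (K : rcfType) (L : finType).
Local Notation C := K[i].

Definition part (T : Type) (z : bool * L -> T) (b : bool) : L -> T := fun l => z (b, l).

Lemma part_bump (F : fieldType) (z : bool * L -> F) b c l s :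
  part (bump z (c, l) s) b = if b == c then bump (part z b) l s else part z b.
Proof.
apply: funext => k; rewrite /part /bump xpair_eqE.
by case: (b == c).
Qed.

Definition double (f : (L -> C) -> C) (z : bool * L -> C) : C :=
  f (part z true) * f (part z false).

Lemma stable_double f : stable f -> stable (double f).
Proof.
move=> [hf hr h0]; split.
- move=> z [[] l] s; rewrite /diff /double !part_bump /= !(hf _ l s) !(hf _ l 1); ring.
- move=> x; have := hr (part x true); have := hr (part x false).
  rewrite /double -![part (emb x) _]/(emb (part x _)).
  by case: (f _) (f _) => [a b] [c d] /= -> ->; rewrite mulr0 mul0r addr0.
- by move=> z hz; rewrite mulf_neq0 // h0 // => l; apply: hz.
Qed.

Lemma rpart_double f x : stable f ->
  rpart (double f) x = rpart f (part x true) * rpart f (part x false).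
Proof.
move=> [_ hr _]; have := hr (part x true); have := hr (part x false).
rewrite /rpart /double -![part (emb x) _]/(emb (part x _)).
by case: (f _) (f _) => [a b] [c d] /= -> ->; rewrite mulr0 subr0.
Qed.

End Product.

(** * Splitting a frame into two balanced parts *)

Section Split.
Variables (K : rcfType) (L : finType) (n : nat) (u : L -> 'rV[K[i]]_n).
Local Notation C := K[i].
Implicit Types (x y : 'rV[C]_n) (z : L -> C) (w : L -> K) (l : L).
Local Notation posdef := (posdef u).
Local Notation Q := (quad u).
Local Notation H := (rpart (gram_det u)).

Definition sqn x : K := \sum_i nsq (x 0 i).

Lemma sqn_gt0 x : x != 0 -> 0 < sqn x.
Proof.
move=> x0; rewrite lt_def sumr_ge0 => [|i _]; last exact: nsq_ge0.
rewrite andbT; apply: contra x0 => /eqP h; apply/eqP/rowP => i; rewrite mxE.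
by apply: nsq_eq0; apply: (psumr_eq0P _ h) => // j _; exact: nsq_ge0.
Qed.

(** Cauchy-Schwarz; [r = 1] in [weighted_cauchy] suffices because [sqn v <= 1]. *)
Lemma nsq_ip_le x v : sqn v <= 1 -> nsq (ip x v) <= sqn x.
Proof.
move=> v1.
have := @weighted_cauchy K 'I_n (fun=> 1) (fun i => x 0 i) (fun i => v 0 i) 1.
move=> /= /(_ (fun c => sumr_ge0 _ (fun i _ => mulr_ge0 ler01 (nsq_ge0 _)))).
have -> : \sum_k 1%:C * (x 0 k * conjc (v 0 k)) = ip x v.
  by apply: eq_bigr => k _; rewrite rmorph1 mul1r.
have E (y : 'rV[C]_n) : \sum_k 1 * nsq (y 0 k) = sqn y.
  by apply: eq_bigr => k _; rewrite mul1r.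
rewrite !E => h; have : nsq (ip x v) * sqn v <= nsq (ip x v) by rewrite ler_piMr
  ?nsq_ge0.
by move: h; rewrite mulr1 expr1n mul1r; lra.
Qed.

Variables (a : K).
Hypotheses (a0 : 0 < a) (u1 : forall l, sqn (u l) <= 1)
  (ha : forall x, a * sqn x <= Q (fun=> 1) x).

Let quad_const (s : K) x : Q (fun=> s) x = s * Q (fun=> 1) x.
Proof. by rewrite /quad mulr_sumr; apply: eq_bigr => l _; rewrite mul1r. Qed.

Lemma posdef_const s : 0 < s -> posdef (fun=> s).
Proof.
move=> s0 x x0; rewrite quad_const mulr_gt0 //.
by apply: lt_le_trans (ha x); rewrite mulr_gt0 // sqn_gt0.
Qed.

(** Bounds the initial barrier [d_l H / H], the leverage score of [u_l]. Were it larger, the weight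
    of [u_l] could be lowered by [r < s * a], making the determinant zero, yet the form would keep
    at least [(s * a - r) * sqn x]. The extra factor [H] avoids fixing its sign. *)
Lemma leverage_le (s : K) l : 0 < s ->
  H (fun=> s) * diff l H (fun=> s) <= (s * a)^-1 * H (fun=> s) ^+ 2.
Proof.
move=> s0; have sa : 0 < s * a by rewrite mulr_gt0.
rewrite leNgt; apply/negP => hlt.
have H0 : H (fun=> s) != 0 := posdef_det_neq0 (posdef_const s0).
have HH : 0 < H (fun=> s) ^+ 2 by rewrite lt_def sqr_ge0 sqrf_eq0 H0.
have HD : 0 < H (fun=> s) * diff l H (fun=> s).
  by apply: lt_trans hlt; rewrite mulr_gt0 // invr_gt0.
have D0 : diff l H (fun=> s) != 0.
  by apply: contraTneq HD => ->; rewrite mulr0 ltxx.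
pose r := H (fun=> s) / diff l H (fun=> s).
have rE : r = H (fun=> s) ^+ 2 / (H (fun=> s) * diff l H (fun=> s)).
  by rewrite /r; field; rewrite H0 D0.
have r0 : 0 < r by rewrite rE divr_gt0.
have rsa : r < s * a.
  by rewrite rE ltr_pdivrMr // mulrC -ltr_pdivrMr // mulrC.
have pd : posdef (bump (fun=> s) l (- r)).
  move=> x x0; rewrite quad_bump quad_const.
  have x1 := sqn_gt0 x0; have h1 := nsq_ip_le x (u1 l).
  have h2 := ler_wpM2l (ltW r0) h1; have h3 := ler_wpM2l (ltW s0) (ha x).
  have h4 : r * sqn x < s * a * sqn x by rewrite ltr_pM2r.
  by lra.
have := posdef_det_neq0 pd; rewrite (multiaffine_rpart (multiaffine_gram_det u)).
by rewrite mulNr /r divfK // subrr eqxx.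
Qed.

(** The barrier argument starts at the constant weight [s] and ends at [s + t]. Nonvanishing above
    the selected corner then says that [s + t] times the full form dominates the form of each
    part. *)
Lemma gram_split (s t : K) : 0 < s -> 0 < t -> 2^-1 <= t * (1 - (s * a)^-1) ->
  exists tau : L -> bool, forall b x,
    \sum_(l | tau l == b) nsq (ip x (u l)) <= (s + t) * \sum_l nsq (ip x (u l)).
Proof.
move=> s0 t0 hst.
have pd1 := posdef_const ltr01; have pds := posdef_const s0.
have hs := stable_gram_det pd1.
have hD := stable_double hs.
have Habove w : lew (fun=> s) w -> 0 < H (fun=> s) * H w.
  exact: gram_det_above.
have ab : above (rpart (double (gram_det u))) (fun=> s).
  move=> y hy; rewrite rpart_double //.
  have := mulr_gt0 (Habove (part y true) (fun l => hy _))
    (Habove (part y false) (fun l => hy _)).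
  have HH : 0 < H (fun=> s) ^+ 2 by rewrite lt_def sqr_ge0 sqrf_eq0 posdef_det_neq0.
  by move=> h; rewrite -(pmulr_lgt0 _ HH); move: h; congr (_ < _); ring.
have [|tau htau] := stable_selection hD ab (c := (s * a)^-1) _ t0 hst.
  move=> [b l]; rewrite rpart_double // -expr2.
  apply: le_trans (leverage_le l s0).
  rewrite /diff !rpart_double // !part_bump le_eqVlt; apply/orP; left; apply/eqP.
  by case: b => /=; rewrite /part; ring.
exists tau => b x.
pose wb l := s + t - (b == tau l)%:R.
(* The other copy is frozen at its corner, so a positive product at [y] gives a nonzero factor
   [H w]. *)
have hwb w : lew wb w -> H w != 0.
  move=> hw; pose y k := if k.1 == b then w k.2 else s + t - (k.1 == tau k.2)%:R.
  have : 0 < rpart (double (gram_det u)) y.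
    by apply: htau => -[c l]; rewrite /y /=; case: (c =P b) => [->|//]; exact: hw.
  rewrite rpart_double //.
  have -> : H (part y true) * H (part y false) = H (part y b) * H (part y (~~ b)).
    by move: y; case: b {wb hw} => //= y; rewrite mulrC.
  have -> : part y b = w by apply: funext => l; rewrite /part /y eqxx.
  by apply: contraTneq => ->; rewrite mul0r ltxx.
(* The vectors of the part are subtracted one at a time. All intermediate weights dominate [wb], so
   [hwb] supplies the nonvanishing for [posdef_step]. *)
have pdwb (r : seq L) : uniq r ->
    posdef (fun l => s + t - ((l \in r) && (b == tau l))%:R).
  elim: r => [_|l r IH /= /andP[nlr ur]].
    by apply: posdef_le (posdef_const (addr_gt0 s0 t0)) => l; rewrite subr0.
  set w := (fun l => _) in IH; have {}IH := IH ur.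
  have [bt|bt] := eqVneq b (tau l); last first.
    rewrite (_ : (fun l0 => _) = w) //; apply: funext => k; rewrite /w inE.
    by case: (eqVneq k l) => //= ->; rewrite (negbTE bt) andbF.
  have -> : (fun k => s + t - ((k \in l :: r) && (b == tau k))%:R) = bump w l (- 1).
    apply: funext => k; rewrite /bump /w inE; case: (eqVneq k l) => //= ->.
    by rewrite (negbTE nlr) -bt eqxx /= subr0.
  apply: posdef_step => // q /andP[q0 q1]; apply: hwb => k.
  rewrite /wb /bump /w; case: (eqVneq k l) => [->|_].
    by rewrite (negbTE nlr) -bt eqxx /= subr0 lerD2l lerN2.
  by rewrite lerD2l lerN2; case: (k \in r) => //=; exact: ler0n.
have := posdef_ge0 x (pdwb _ (enum_uniq L)); rewrite /quad.
move=> h; rewrite [\sum_(l | _) _]big_mkcond /= mulr_sumr -subr_ge0 -sumrB.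
move: h; congr (_ <= _).
apply: eq_bigr => l _; rewrite mem_enum /= [b == _]eq_sym.
by case: (tau l == b) => /=; ring.
Qed.

End Split.

(** * Thinning a tight frame *)

Section Frame.
Variables (K : rcfType) (L : finType) (n : nat) (u : L -> 'rV[K[i]]_n).
Implicit Types (J : {set L}) (r : K) (x : 'rV[K[i]]_n).
Hypothesis u1 : forall l, sqn (u l) <= 1.

Definition energy J x : K := \sum_(l in J) nsq (ip x (u l)).

(** [r] is the square root of the lower frame bound, so that the relative halving error is
    [2 / r]. *)
Definition frame J r := forall x,
  r ^+ 2 * sqn x <= energy J x /\ energy J x <= (r ^+ 2 + 80 * r) * sqn x.

Lemma sqn_ge0 x : 0 <= sqn x.
Proof. by apply: sumr_ge0 => i _; exact: nsq_ge0. Qed.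

Lemma nsq0 : nsq (0 : K[i]) = 0.
Proof. by rewrite /nsq /= expr0n addr0. Qed.

Lemma frame_halving J r : 80 <= r -> frame J r ->
  exists J', frame J' (Num.sqrt (r ^+ 2 / 2 - 2 * r)).
Proof.
move=> r80 hJ; have r0 : 0 < r by lra.
(* Vectors outside [J] become zero, so that [gram_split] applies over the whole index type. *)
pose v l := if l \in J then u l else 0.
have ipv x l : nsq (ip x (v l)) = if l \in J then nsq (ip x (u l)) else 0.
  rewrite /v; case: ifP => // _; rewrite (_ : ip x 0 = 0) ?nsq0 //.
  by rewrite /ip big1 // => i _; rewrite mxE conjc0 mulr0.
have v1 l : sqn (v l) <= 1.
  rewrite /v; case: ifP => // _; rewrite /sqn big1 ?ler01 // => i _.
  by rewrite mxE nsq0.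
have ev x : \sum_l nsq (ip x (v l)) = energy J x.
  by rewrite /energy [RHS]big_mkcond; apply: eq_bigr => l _; rewrite ipv.
have ha x : r ^+ 2 * sqn x <= quad v (fun=> 1) x.
  rewrite /quad; under eq_bigr do rewrite mul1r.
  by rewrite ev; have [] := hJ x.
(* The choice [s = r^-1], [t = 2^-1 + r^-1] gives [s * a = r] and [s + t = 2^-1 + 2 / r]. *)
have hst : 2^-1 <= (2^-1 + r^-1) * (1 - (r^-1 * r ^+ 2)^-1).
  have -> : (r^-1 * r ^+ 2) = r by field; lra.
  have : r^-1 * r^-1 <= 2^-1 * r^-1.
    by rewrite ler_wpM2r ?invr_ge0 ?(ltW r0) // lef_pV2 ?posrE //; lra.
  lra.
have ri0 : 0 < r^-1 by rewrite invr_gt0.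
have t0 : 0 < 2^-1 + r^-1 by lra.
have [tau htau] := gram_split (exprn_gt0 2 r0) v1 ha ri0 t0 hst.
pose Jb b := [set l in J | tau l == b].
have eb b x : \sum_(l | tau l == b) nsq (ip x (v l)) = energy (Jb b) x.
  rewrite /energy [LHS]big_mkcond [RHS]big_mkcond; apply: eq_bigr => l _.
  by rewrite ipv inE; case: (l \in J); rewrite ?if_same.
have esum x : energy J x = energy (Jb true) x + energy (Jb false) x.
  rewrite -!eb -ev (bigID (fun l => tau l == true)) /=; congr (_ + _).
  by apply: eq_bigl => l; case: (tau l).
have r80' : 80 * r <= r ^+ 2 by rewrite expr2 ler_wpM2r // ltW.
have q0 : 0 <= r ^+ 2 / 2 - 2 * r by lra.
exists (Jb true) => x; rewrite sqr_sqrtr //.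
have [lo hi] := hJ x; have hT := htau true x; have hF := htau false x.
rewrite !eb ev in hT hF; have e0 := sqn_ge0 x; have := esum x.
split.
  (* The lower bound for one part comes from the upper bound for the other. *)
  have : (2^-1 - 2 / r) * (r ^+ 2 * sqn x) <= (2^-1 - 2 / r) * energy J x.
    apply: ler_wpM2l => //; rewrite subr_ge0 ler_pdivrMr //; lra.
  have -> : (2^-1 - 2 / r) * (r ^+ 2 * sqn x) = (r ^+ 2 / 2 - 2 * r) * sqn x.
    by field; lra.
  lra.
apply: (le_trans hT).
apply: (@le_trans _ _ ((2^-1 + 2 / r) * ((r ^+ 2 + 80 * r) * sqn x))).
  have -> : r^-1 + (2^-1 + r^-1) = 2^-1 + 2 / r by field; lra.
  by apply: ler_wpM2l => //; lra.
rewrite mulrA; apply: ler_wpM2r => //.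
have -> : (2^-1 + 2 / r) * (r ^+ 2 + 80 * r) = r ^+ 2 / 2 + 42 * r + 160 by field; lra.
(* Then [80] times the new parameter is at least [48 * r], and [42 * r + 160 <= 46 * r] because
   [r >= 80]. *)
have : (3 / 5) * r <= Num.sqrt (r ^+ 2 / 2 - 2 * r).
  rewrite -[(3 / 5) * r]ger0_norm; last by rewrite mulr_ge0 //; lra.
  rewrite -sqrtr_sqr; apply: ler_wsqrtr; rewrite exprMn; lra.
lra.
Qed.

(* [r ^+ 2] essentially halves at each step, so the errors [O(r)] of the halvings
   form a geometric series, which the slack [80 * r] in [frame] absorbs. At
   [r <= 80] the upper bound is at most [80 ^+ 2 + 80 * 80 = 12800]. *)
Lemma frame_thinning (m : nat) J r : 1 <= r -> r ^+ 2 <= 6400 * 2 ^+ m -> frame J r ->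
  exists J', forall x, sqn x <= energy J' x /\ energy J' x <= 12800 * sqn x.
Proof.
have stop J1 r1 : 1 <= r1 -> r1 <= 80 -> frame J1 r1 ->
    exists J', forall x, sqn x <= energy J' x /\ energy J' x <= 12800 * sqn x.
  move=> h1 h80 hJ; exists J1 => x; have [lo hi] := hJ x; have e0 := sqn_ge0 x.
  split.
    apply: le_trans lo; rewrite ler_peMl // expr2; nra.
  apply: (le_trans hi); apply: ler_wpM2r => //; nra.
elim: m J r => [|m IH] J r r1 hr hJ.
  apply: stop hJ => //; rewrite leNgt; apply/negP => h; move: hr; rewrite expr0; nra.
have [r80|r80] := leP r 80; first exact: stop hJ.
have [J' hJ'] := frame_halving (ltW r80) hJ.
have r2 : 80 * r <= r ^+ 2 by rewrite expr2; nra.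
apply: IH hJ'.
  rewrite -[leLHS]sqrtr1; apply: ler_wsqrtr; lra.
rewrite sqr_sqrtr; last lra.
by move: hr; rewrite (exprS 2 m); lra.
Qed.

End Frame.

(** * Characters of an integer lattice *)

Section Cis.
Variable K : realType.
Implicit Types (s t : K).

Lemma cis0 : cis (0 : K) = 1.
Proof. by rewrite /cis cos0 sin0. Qed.

Lemma cisD s t : cis (s + t) = cis s * cis t.
Proof.
apply/eqP; rewrite eq_complex /= cosD sinD eqxx /=; apply/eqP; ring.
Qed.

Lemma conjc_cis t : conjc (cis t) = cis (- t).
Proof. by rewrite /cis /= cosN sinN. Qed.

Lemma cis_mulrn t n : cis (t *+ n) = cis t ^+ n.
Proof.
elim: n => [|n IH]; first by rewrite mulr0n cis0 expr0.
by rewrite mulrS cisD IH exprS.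
Qed.

Lemma cis_2pi_int (k : int) : cis (2 * pi * k%:~R : K) = 1.
Proof.
have h (n : nat) : cis (2 * pi * n%:R : K) = 1.
  rewrite mulr_natr cis_mulrn (_ : cis _ = 1) ?expr1n //.
  by rewrite mulr_natl /cis cos2pi sin2pi.
case: k => n; first exact: h.
by rewrite NegzE mulrNz mulrN -conjc_cis h conjc1.
Qed.

Lemma cis_2pi_neq1 t : 0 < t < 1 -> cis (2 * pi * t) != 1.
Proof.
move=> /andP[t0 t1]; apply/eqP => /(congr1 (@complex.Re K)) /=.
have -> : 2 * pi * t = (pi * t) *+ 2 by rewrite mulr2n; ring.
have p0 := pi_gt0 K.
have := sin_gt0_pi (x := pi * t).
rewrite mulr_gt0 //= gtr_pMr // t1 => /(_ isT) h.
have h2 : 0 < sin (pi * t) ^+ 2 by rewrite exprn_gt0.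
rewrite cos_mulr2n cos2sin2; lra.
Qed.

(** The character [c |-> e^(-2 pi i c / D)] of the integers modulo [D]. *)
Definition unit_root (D c : int) : K[i] := cis (- (2 * pi * (c%:~R / D%:~R))).

Lemma unit_rootD D (c c' : int) : unit_root D (c + c') = unit_root D c * unit_root D c'.
Proof. by rewrite /unit_root -cisD rmorphD /=; congr cis; ring. Qed.

Lemma unit_root_sum D (I : Type) (r : seq I) (P : pred I) (c : I -> int) :
  unit_root D (\sum_(i <- r | P i) c i) = \prod_(i <- r | P i) unit_root D (c i).
Proof.
apply: (big_morph (unit_root D) (@unit_rootD D)).
by rewrite /unit_root mul0r mulr0 oppr0 cis0.
Qed.

Lemma unit_rootM D (c : int) (n : nat) : unit_root D (c * n%:Z) = unit_root D c ^+ n.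
Proof.
rewrite /unit_root -cis_mulrn; congr cis;
  rewrite rmorphM /= -pmulrn -[RHS]mulr_natr; ring.
Qed.

Lemma unit_root_eq1 (D c : int) : D != 0 -> unit_root D c = 1 -> (D %| c)%Z.
Proof.
move=> D0 h; have Dr0 : (D%:~R : K) != 0 by rewrite intr_eq0.
apply/dvdz_mod0P/eqP; apply/negPn/negP => r0.
have : unit_root D (c %% D)%Z = 1.
  move: h; rewrite {1}(divz_eq c D) unit_rootD => <-.
  rewrite -[LHS]mul1r; congr (_ * _); rewrite /unit_root rmorphM /= mulfK //.
  by rewrite -mulrN -rmorphN cis_2pi_int.
have rge := modz_ge0 c D0; have rlt := ltz_mod c D0.
set r := (c %% D)%Z in r0 rge rlt *.
(* [D] may be negative, hence the absolute value here and the conjugation below. *)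
have tlt : 0 < `|(r%:~R / D%:~R : K)| < 1.
  rewrite normr_gt0 mulf_neq0 ?invr_eq0 ?intr_eq0 //=.
  rewrite normrM normfV ltr_pdivrMr ?normr_gt0 // mul1r.
  by rewrite -!intr_norm ltr_int ger0_norm.
have := cis_2pi_neq1 tlt; rewrite /unit_root; set q := (_ / _).
case: (ger0P q) => _ hq e; last by move: hq; rewrite mulrN e eqxx.
by move: hq; rewrite -[_ * q]opprK -conjc_cis e conjc1 eqxx.
Qed.

(** A geometric sum whose ratio is a root of unity of order dividing [|D|]; the ratio is [1] exactly
    when [D] divides [c]. *)
Lemma unit_root_geom (D c : int) : D != 0 ->
  \sum_(k < `|D|%N) unit_root D (c * k%:Z) = if (D %| c)%Z then `|D|%N%:R else 0.
Proof.
move=> D0; have Dr0 : (D%:~R : K) != 0 by rewrite intr_eq0.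
under eq_bigr do rewrite unit_rootM.
have rD : unit_root D c ^+ `|D|%N = 1.
  rewrite -unit_rootM.
  have -> : c * `|D|%N = (c * Num.sg D) * D by rewrite -mulrA abszE -normrEsg.
  rewrite /unit_root rmorphM /= mulfK // -mulrN -rmorphN; exact: cis_2pi_int.
case: ifPn => [/dvdzP[q ->]|ndv].
  have -> : unit_root D (q * D) = 1.
    rewrite /unit_root rmorphM /= mulfK // -mulrN -rmorphN; exact: cis_2pi_int.
  under eq_bigr do rewrite expr1n.
  by rewrite sumr_const card_ord.
have n1 : unit_root D c - 1 != 0.
  by rewrite subr_eq0; apply: contra ndv => /eqP /(unit_root_eq1 D0).
by apply: (mulfI n1); rewrite -subrX1 rD subrr mulr0.
Qed.

End Cis.

(** * Injectivity of digit expansions *)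

Lemma expansive_det_neq0 (K : realType) d (R : 'M[int]_d) :
  expansive K R -> \det R != 0.
Proof.
move=> hR; apply/negP => /eqP R0.
have /det0P[v v0 hv] : \det (map_mx intr R : 'M[K[i]]_d) == 0.
  by rewrite det_map_mx R0.
have /hR : eigenvalue (map_mx intr R : 'M[K[i]]_d) 0.
  by apply/eigenvalueP; exists v => //; rewrite hv scale0r.
by rewrite normc0 ltr10.
Qed.

Lemma mulmx_int_inj d (R : 'M[int]_d) (x : 'cV[int]_d) :
  \det R != 0 -> R *m x = 0 -> x = 0.
Proof.
move=> R0 /(congr1 (mulmx (\adj R))); rewrite mulmxA mul_adj_mx mulmx0 mul_scalar_mx.
move/matrixP => h; apply/matrixP => i j; have := h i j; rewrite !mxE => /eqP.
by rewrite mulf_eq0 (negbTE R0) => /eqP.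
Qed.

(** The lowest digits agree modulo [R], hence are equal; cancelling them and one factor [R] leaves
    the case [n]. Working modulo [R ^+ n] gives incongruence of distinct digit sums, and [z = 0]
    gives uniqueness of expansions. *)
Lemma digit_sum_inj d (R : 'M[int]_d) (B : {fset 'cV[int]_d}) :
  \det R != 0 -> simple_digit_set R B ->
  forall n (f g : 'I_n -> 'cV[int]_d) z,
  (forall j, f j \in B) -> (forall j, g j \in B) ->
  \sum_(j < n) R ^+ j *m f j - \sum_(j < n) R ^+ j *m g j = R ^+ n *m z ->
  f =1 g.
Proof.
move=> R0 hB; elim=> [|n IH] f g z fB gB e; first by case.
have shift (h : 'I_n.+1 -> 'cV[int]_d) : \sum_(j < n.+1) R ^+ j *m h j =
    h ord0 + R *m \sum_(j < n) R ^+ j *m h (lift ord0 j).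
  rewrite big_ord_recl expr0 mul1mx mulmx_sumr; congr (_ + _).
  by apply: eq_bigr => j _; rewrite exprS mulmxA.
move: e; rewrite !shift exprS -[R * _]/(R *m _) -mulmxA => e.
have e0 : f ord0 = g ord0.
  apply: hB => //; exists (R ^+ n *m z - (\sum_(j < n) R ^+ j *m f (lift ord0 j)
    - \sum_(j < n) R ^+ j *m g (lift ord0 j))).
  rewrite mulmxBr -e mulmxBr; set F := R *m _; set G := R *m _.
  by rewrite [g _ + _]addrC !opprD !opprK !addrA; apply/matrixP => i j;
    rewrite !mxE; ring.
have e1 : \sum_(j < n) R ^+ j *m f (lift ord0 j) -
    \sum_(j < n) R ^+ j *m g (lift ord0 j) = R ^+ n *m z.
  apply/eqP; rewrite -subr_eq0; apply/eqP; apply: (mulmx_int_inj R0).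
  by rewrite !mulmxBr -e e0 [in X in _ - X]opprD [in X in _ - X]addrACA subrr add0r
    subrr.
move=> j; case: (unliftP ord0 j) => [k|] ->; last exact: e0.
exact: (IH _ _ z (fun k => fB (lift ord0 k)) (fun k => gB (lift ord0 k)) e1).
Qed.

Lemma conjc_unit_root (K : realType) (D c : int) :
  conjc (unit_root K D c) = unit_root K D (- c).
Proof. by rewrite /unit_root conjc_cis mulrNz mulNr mulrN. Qed.

(** * Orthogonality of characters on a box *)

Section Orthogonality.
Variables (K : realType) (d : nat) (A : 'M[int]_d).
Hypothesis A0 : \det A != 0.

(** The side is [|det A|] because [A^-1] has denominator [det A], so each coordinate runs over whole
    periods. *)
Definition box := {ffun 'I_d -> 'I_`|\det A|}.

Definition box_vec (l : box) : 'cV[int]_d := \col_i (l i)%:Z.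

(** This is [e^(-2 pi i <A^-1 b, l>)], with [A^-1] written as adjugate over determinant to get an
    integer numerator. *)
Definition lattice_char (b : 'cV[int]_d) (l : box) : K[i] :=
  unit_root K (\det A) (\sum_i (\adj A *m b) i ord0 * (l i)%:Z).

Lemma box_vec_inj : injective box_vec.
Proof.
move=> l l' /matrixP h; apply/ffunP => i; apply: val_inj => /=.
by have := h i 0; rewrite !mxE => -[].
Qed.

(** The sum over the box factors into one geometric sum per coordinate. *)
Lemma lattice_char_sum b : \sum_l lattice_char b l =
  if [forall i, (\det A %| (\adj A *m b) i ord0)%Z] then (`|\det A| ^ d)%N%:R else 0.
Proof.
under eq_bigr do rewrite /lattice_char unit_root_sum.
rewrite -(bigA_distr_bigA (fun i (k : 'I_`|\det A|) =>
  unit_root K (\det A) ((\adj A *m b) i ord0 * k%:Z))) /=.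
under eq_bigr do rewrite unit_root_geom //.
case: forallP => [h|/forallP]; last first.
  by rewrite negb_forall => /existsP[i /negbTE hi]; rewrite (bigD1 i) //= hi mul0r.
under eq_bigr do rewrite h.
by rewrite prodr_const card_ord natrX.
Qed.

(** A nonzero sum means that [A^-1 (b - b')] is integral, that is, [b] and [b'] are congruent modulo
    [A]. *)
Lemma lattice_char_orthogonal b b' :
  ((exists z, b - b' = A *m z) -> b = b') ->
  \sum_l lattice_char b l * conjc (lattice_char b' l) =
  if b == b' then (`|\det A| ^ d)%N%:R else 0.
Proof.
move=> hb.
have E l : lattice_char b l * conjc (lattice_char b' l) = lattice_char (b - b') l.
  rewrite /lattice_char conjc_unit_root -unit_rootD; congr unit_root.
  rewrite -sumrB; apply: eq_bigr => i _; rewrite mulmxBr !mxE; ring.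
under eq_bigr do rewrite E.
rewrite lattice_char_sum; congr (if _ then _ else _).
apply/forallP/eqP => [h|->].
  apply: hb; exists (\col_i ((\adj A *m (b - b')) i ord0 %/ \det A)%Z).
  have hz : \adj A *m (b - b') = \det A *: \col_i ((\adj A *m (b - b')) i ord0
      %/ \det A)%Z.
    apply/matrixP => i j; rewrite [j]ord1 [RHS]mxE [X in _ * X]mxE mulrC divzK //.
  have := congr1 (mulmx A) hz; rewrite mulmxA mul_mx_adj mul_scalar_mx -scalemxAr.
  move/matrixP => h'; apply/matrixP => i j; have := h' i j.
  by rewrite [LHS]mxE [RHS]mxE => /(mulfI A0).
by move=> i; rewrite subrr mulmx0 mxE dvdz0.
Qed.

End Orthogonality.

(** Orthogonal rows of equal norm make the columns a tight frame: expand the squares and exchange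
    the sums. *)
Lemma tight_frame (K : realType) (T L : finType) (E : T -> L -> K[i]) (s : K) :
  (forall t t', \sum_l E t l * conjc (E t' l) = if t == t' then s%:C else 0) ->
  forall w : T -> K[i],
    \sum_l nsq (\sum_t w t * E t l) = s * \sum_t nsq (w t).
Proof.
move=> hE w; apply: (@complexI K); rewrite rmorphM /= !raddf_sum /=.
under eq_bigr do rewrite -mulcJ mulr_suml.
rewrite exchange_big mulr_sumr; apply: eq_bigr => t _ /=.
under eq_bigr do rewrite rmorph_sum /= mulr_sumr.
rewrite exchange_big (bigD1 t) //= [X in _ + X]big1 ?addr0 => [|t' tt'].
  have -> : s%:C * (nsq (w t))%:C = w t * conjc (w t) * \sum_l E t l * conjc (E t l).
    by rewrite hE eqxx mulcJ mulrC.
  by rewrite mulr_sumr; apply: eq_bigr => l _; rewrite conjcM; ring.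
transitivity (w t * conjc (w t') * \sum_l E t l * conjc (E t' l)).
  by rewrite mulr_sumr; apply: eq_bigr => l _; rewrite conjcM; ring.
by rewrite hE eq_sym (negbTE tt') mulr0.
Qed.

Lemma normc_nsq (K : realType) (c : K[i]) : normc c ^+ 2 = nsq c.
Proof. by case: c => a b; rewrite /normc sqr_sqrtr // addr_ge0 ?sqr_ge0. Qed.

Lemma nsqM (K : realType) (c d : K[i]) : nsq (c * d) = nsq c * nsq d.
Proof. by case: c d => [a b] [e f]; rewrite /nsq /=; ring. Qed.

Lemma nsq_conjc (K : realType) (c : K[i]) : nsq (conjc c) = nsq c.
Proof. by case: c => a b; rewrite /nsq /= sqrrN. Qed.

Lemma nsq_cis (K : realType) (t : K) : nsq (cis t) = 1.
Proof. by rewrite /nsq /= cos2Dsin2. Qed.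

Lemma intr_mxX (K : realType) d (R : 'M[int]_d) n :
  intr_mx K R ^+ n = intr_mx K (R ^+ n).
Proof. by rewrite /intr_mx rmorphXn. Qed.

Lemma det_exp (T : comNzRingType) d (R : 'M[T]_d) n : \det (R ^+ n) = \det R ^+ n.
Proof. by elim: n => [|n IH]; rewrite ?expr0 ?det1 // !exprS -IH -det_mulmx. Qed.

Lemma digit_phase_box (K : realType) d (R : 'M[int]_d) n b (l : box (R ^+ n)) :
  \det (R ^+ n) != 0 ->
  cis (- (2 * pi * digit_phase K R n b (box_vec l))) = lattice_char K b l.
Proof.
move=> A0; rewrite /lattice_char /unit_root; congr (cis (- (_ * _))).
rewrite /digit_phase intr_mxX; set A := R ^+ n.
have uA : intr_mx K A \in unitmx.
  by rewrite unitmxE unitfE /intr_mx det_map_mx intr_eq0.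
rewrite /dotv /invmx uA /intr_mx det_map_mx -map_mx_adj -scalemxAl -map_mxM.
rewrite [X in _ = X / _]rmorph_sum /= mulr_suml; apply: eq_bigr => i _.
rewrite mxE [X in _ * X * _]mxE ![(box_vec _ ^ _)%sesqui _ _]mxE.
by rewrite [box_vec _ _ _]mxE rmorphM /= [RHS]mulrC mulrA.
Qed.

Lemma card_digit_sums d (R : 'M[int]_d) (B : {fset 'cV[int]_d}) n :
  \det R != 0 -> simple_digit_set R B -> #|{: digit_sums R B n}| = (#|` B| ^ n)%N.
Proof.
move=> R0 hB; rewrite -cardfE card_imfset /=; last first.
  move=> f g e; apply/ffunP => j; apply: val_inj.
  apply: (digit_sum_inj R0 hB (f := val \o f) (g := val \o g) (z := 0)) => [k|k|];
    try exact: valP.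
  by rewrite mulmx0 [X in X - _](_ : _ = \sum_(j < n) R ^+ j *m val (g j)) ?subrr.
rewrite -cardE card_ffun card_ord; congr (_ ^ _)%N.
by rewrite -cardfE.
Qed.

(** * Fourier frames on digit sums *)

Local Open Scope ring_scope.
Local Open Scope classical_set_scope.
Local Open Scope complex_scope.

Section FourierFrame.
Variables (K : realType) (d : nat) (R : 'M[int]_d) (B : {fset 'cV[int]_d}) (n : nat).
Hypotheses (R0 : \det R != 0) (hB : simple_digit_set R B).
Local Notation T := (digit_sums R B n).
Local Notation N := (#|{: T}|).

Lemma det_pow_neq0 : \det (R ^+ n) != 0.
Proof. by rewrite det_exp expf_neq0. Qed.

(** Conjugated because [ip] conjugates its second argument. *)
Definition fourier_vec (l : box (R ^+ n)) : 'rV[K[i]]_N :=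
  \row_k conjc ((1 / Num.sqrt N%:R)%:C * lattice_char K (val (enum_val k)) l).

Definition coord_row (w : T -> K[i]) : 'rV[K[i]]_N := \row_k w (enum_val k).

Lemma sum_enum_val (V : nmodType) (F : T -> V) :
  \sum_(k < N) F (enum_val k) = \sum_b F b.
Proof. by rewrite [RHS](reindex _ (onW_bij _ (enum_val_bij _))). Qed.

Lemma fourier_ip (w : T -> K[i]) l :
  ip (coord_row w) (fourier_vec l) = normalized_fourier w (box_vec l).
Proof.
rewrite /ip /normalized_fourier -(card_digit_sums n R0 hB) -sum_enum_val mulr_sumr.
apply: eq_bigr => k _; rewrite !mxE conjcK digit_phase_box ?det_pow_neq0 //.
by rewrite mulrCA.
Qed.

Lemma sqn_coord_row w : sqn (coord_row w) = \sum_b normc (w b) ^+ 2.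
Proof.
rewrite -sum_enum_val; apply: eq_bigr => k _.
by rewrite mxE normc_nsq.
Qed.

Lemma digit_sums_incongruent (b b' : T) :
  (exists z, val b - val b' = R ^+ n *m z) -> b = b'.
Proof.
move=> [z hz]; apply: val_inj.
have /imfsetP[/= f _ ef] := valP b; have /imfsetP[/= g _ eg] := valP b'.
have h := digit_sum_inj R0 hB (f := val \o f) (g := val \o g) (z := z).
rewrite ef eg; apply: eq_bigr => j _; congr (_ *m _); apply: h => [k|k|];
  try exact: valP.
by rewrite -hz /= ef eg.
Qed.

Hypothesis N0 : (0 < N)%N.

Lemma normalization_sqr : nsq ((1 / Num.sqrt N%:R)%:C : K[i]) = N%:R^-1.
Proof.
by rewrite /nsq /= expr0n addr0 mul1r exprVn sqr_sqrtr.
Qed.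

Lemma sqn_fourier_vec l : sqn (fourier_vec l) = 1.
Proof.
rewrite /sqn.
under eq_bigr do rewrite mxE nsq_conjc nsqM normalization_sqr /lattice_char
  /unit_root nsq_cis mulr1.
by rewrite sumr_const card_ord -[X in X = _]mulr_natl divff // pnatr_eq0 -lt0n.
Qed.

(** The number of vectors over the dimension, which is the frame bound of a tight frame of unit
    vectors. *)
Definition redundancy : K := (`|\det (R ^+ n)| ^ d)%N%:R / N%:R.

Lemma fourier_tight (x : 'rV[K[i]]_N) :
  \sum_l nsq (ip x (fourier_vec l)) = redundancy * sqn x.
Proof.
pose E (k : 'I_N) (l : box (R ^+ n)) : K[i] := (1 / Num.sqrt N%:R)%:C *
  lattice_char K (val (enum_val k)) l.
rewrite -(@tight_frame _ _ _ E).
  by apply: eq_bigr => l _; congr nsq; apply: eq_bigr => k _; rewrite mxE conjcK.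
move=> k k'; rewrite /E.
under eq_bigr do rewrite conjcM mulrACA.
rewrite -mulr_sumr mulcJ normalization_sqr lattice_char_orthogonal
  ?det_pow_neq0 //; last first.
  by move=> /digit_sums_incongruent ->.
rewrite (inj_eq val_inj) (inj_eq enum_val_inj).
case: eqP => _; last by rewrite mulr0.
by rewrite /redundancy rmorphM /= rmorph_nat mulrC.
Qed.

(** Tightness is tested on a member of the frame, whose own term already contributes [1]. *)
Lemma redundancy_ge1 : 1 <= redundancy.
Proof.
have D0 : (0 < `|\det (R ^+ n)|)%N by rewrite absz_gt0 det_pow_neq0.
pose l0 : box (R ^+ n) := [ffun=> Ordinal D0].
have := fourier_tight (fourier_vec l0); rewrite sqn_fourier_vec mulr1 => <-.
rewrite (bigD1 l0) //=; apply: ler_wpDr.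
  by apply: sumr_ge0 => l _; exact: nsq_ge0.
have -> : ip (fourier_vec l0) (fourier_vec l0) = 1.
  rewrite -(rmorph1 (real_complex K)) -(sqn_fourier_vec l0) /sqn raddf_sum.
  by apply: eq_bigr => k _; rewrite mulcJ.
by rewrite /nsq /= expr1n expr0n addr0.
Qed.

Lemma fourier_subframe : exists J : {set box (R ^+ n)}, forall x,
  sqn x <= energy fourier_vec J x /\ energy fourier_vec J x <= 12800 * sqn x.
Proof.
have r1 := redundancy_ge1; have r0 : 0 <= redundancy by lra.
(* Enough halvings, as [redundancy < m < 2 ^+ m]. *)
pose m := Num.bound redundancy.
apply: (@frame_thinning K _ _ fourier_vec _ m [set: box (R ^+ n)]%SET
  (Num.sqrt redundancy)).
- by move=> l; rewrite sqn_fourier_vec.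
- by rewrite -[leLHS]sqrtr1 ler_wsqrtr.
- rewrite sqr_sqrtr //; apply: ltW; apply: lt_trans (archi_boundP r0) _.
  apply: (@le_lt_trans _ _ (2 ^+ m)); first by rewrite -natrX ler_nat ltnW // ltn_expl.
  by rewrite ltr_pMl ?exprn_gt0 // ltr1n.
move=> x; rewrite /energy sqr_sqrtr //.
have -> : \sum_(l in [set: box (R ^+ n)]%SET) nsq (ip x (fourier_vec l)) =
  redundancy * sqn x.
  by rewrite -fourier_tight; apply: eq_bigl => l; rewrite inE.
split=> //; apply: ler_wpM2r; first exact: sqn_ge0.
by rewrite lerDl mulr_ge0 ?sqrtr_ge0.
Qed.

End FourierFrame.

Lemma esum_box (K : realType) d (A : 'M[int]_d) (J : {set box A})
    (F : 'cV[int]_d -> K) : (forall l, 0 <= F l) ->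
  (\esum_(l in @box_vec d A @` [set` J]) (F l)%:E = (\sum_(l in J) F (box_vec l))%:E)%E.
Proof.
move=> F0; rewrite esum_image; last by move=> l l' _ _; exact: box_vec_inj.
rewrite esum_fset; last by move=> l _; rewrite lee_fin.
  by rewrite -(@bigfs _ _ _ _ (index_enum (box A)) (mem J)) ?index_enum_uniq
    ?sumEFin // => l _; rewrite mem_index_enum.
exact: finite_finset.
Qed.

Theorem proposition1p10 (K : realType) :
  exists c0 C0 : K, 0 < c0 /\ c0 < C0 /\
  forall (d : nat) (R : 'M[int]_d) (B : {fset 'cV[int]_d}),
    expansive K R -> simple_digit_set R B ->
  forall n : nat, (1 <= n)%N ->
  exists J : set 'cV[int]_d,
  forall w : digit_sums R B n -> K[i],
    ((c0 * \sum_(b : digit_sums R B n) normc (w b) ^+ 2)%:E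
       <= \esum_(l in J) (normc (normalized_fourier w l) ^+ 2)%:E)%E /\
    (\esum_(l in J) (normc (normalized_fourier w l) ^+ 2)%:E
       <= (C0 * \sum_(b : digit_sums R B n) normc (w b) ^+ 2)%:E)%E.
Proof.
exists 1, 12800; split=> //; split; first by rewrite ltr1n.
move=> d R B hR hB n _; have R0 := expansive_det_neq0 hR.
have [N0|N0] := posnP #|{: digit_sums R B n}|.
  (* Without digit sums both outer bounds are [0], and the empty set works. *)
  exists set0 => w; rewrite esum_set0 big_pred0 ?mulr0 // => b.
  by have := card0_eq N0 b; rewrite !inE.
have [J hJ] := fourier_subframe K R0 hB N0.
exists (@box_vec d (R ^+ n) @` [set` J]) => w.
rewrite esum_box => [|l]; last exact: sqr_ge0.
have -> : \sum_(l in J) normc (normalized_fourier w (box_vec l)) ^+ 2 =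
    energy (@fourier_vec K d R B n) J (coord_row w).
  by apply: eq_bigr => l _; rewrite normc_nsq fourier_ip.
by rewrite !lee_fin -!sqn_coord_row mul1r; exact: hJ.
Qed.
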